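(* Every forcing set of permutations (whose elements may have arbitrary, possibly different, orders) has at least four elements.
   Context: For $k\in\mathbb{N}$, a $k$-permutation (permutation of order $k$) is a bijection of $[k]=\{1,\dots,k\}$; the order of $\pi$ is denoted $|\pi|$. For an $n$-permutation $\Pi$ and a $k$-permutation $\pi$, the density $d(\pi,\Pi)$ is the probability that a uniformly random $k$-element subset $\{a_1<\dots<a_k\}\subseteq[n]$ satisfies: for all $i,j\in[k]$, $\pi(i)<\pi(j)$ if and only if $\Pi(a_i)<\Pi(a_j)$; if $k>n$ we set $d(\pi,\Pi)=0$. A sequence $(\Pi_i)_{i\in\mathbb{N}}$ of permutations is quasirandom if for every permutation $\pi$ the limit $\lim_{i\to\infty} d(\pi,\Pi_i)$ exists and equals $1/|\pi|!$. A set $S$ of permutations is forcing if every sequence $(\Pi_i)_{i\in\mathbb{N}}$ of permutations with $\lim_{i\to\infty}d(\pi,\Pi_i)=1/|\pi|!$ for all $\pi\in S$ is quasirandom. *)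

(* Defs.v *)
From HB Require Import structures.
From mathcomp Require Import all_boot all_order all_algebra all_fingroup.
From mathcomp Require Import all_classical all_reals all_analysis.
Set Implicit Arguments. Unset Strict Implicit. Unset Printing Implicit Defensive.
Import Order.TTheory GRing.Theory Num.Theory.
Import numFieldNormedType.Exports.
Local Open Scope classical_set_scope.
Local Open Scope ring_scope.

Definition perm_t := {k : nat & 'S_k}.

Definition porder (p : perm_t) : nat := tag p.

(* value of the permutation at position x (0-based), 0 outside the domain *)
Definition pat_val (p : perm_t) (x : nat) : nat :=
  match @insub nat (fun y => y < tag p)%N 'I_(tag p) x with
  | Some y => val (tagged p y)
  | None => 0%N
  end.

Definition occurs (pi Pi : perm_t) (A : {set 'I_(tag Pi)}) : bool :=
  let s := sort leq [seq val x | x <- enum A] in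
  [forall i : 'I_(tag pi), forall j : 'I_(tag pi),
     (pat_val pi i < pat_val pi j)%N == (pat_val Pi (nth 0%N s i) < pat_val Pi (nth 0%N s j))%N].

Definition density (R : realType) (pi Pi : perm_t) : R :=
  if (tag pi <= tag Pi)%N then
    #|[set A : {set 'I_(tag Pi)} | (#|A| == tag pi) && @occurs pi Pi A]|%:R
      / 'C(tag Pi, tag pi)%:R
  else 0.

Definition quasirandom (R : realType) (P : nat -> perm_t) : Prop :=
  forall pi : perm_t,
    density R pi (P i) @[i --> \oo] --> (((porder pi)`!%:R)^-1 : R).

Definition forcing (R : realType) (S : set perm_t) : Prop :=
  forall P : nat -> perm_t,
    (forall pi, S pi ->
       density R pi (P i) @[i --> \oo] --> (((porder pi)`!%:R)^-1 : R)) ->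
    quasirandom R P.

(* Main.v *)
(* A pattern set with at most three elements, all of order at most 3, is defeated by the constant
   sequence of a 3-symmetric permutation of order 9.

   Otherwise perturb the uniform measure on the unit square by step functions. The derivative of the
   density of a k-permutation p at the uniform measure is given by the polynomial
   sum_i B_i(x) B_{p(i)}(y) in the Bernstein basis of degree k - 1. If these polynomials are linearly
   independent modulo constants for a list of patterns, then Newton's method finds a step measure for
   which all listed patterns but the last have their quasirandom density, while the last one does not;
   this step measure is the limit of permutations. Restricting to the sides of the square, where each
   polynomial becomes a single Bernstein polynomial, shows that at most three patterns, one of order at
   least 4, are independent, once 21 is dropped if 12 is present (their densities add up to 1). The last
   pattern is any one of larger order, which preserves independence for reasons of degree. *)

Require Import Defs.
From mathcomp Require Import all_boot all_order all_algebra all_fingroup.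
From mathcomp Require Import all_classical all_reals all_analysis.
From mathcomp Require Import ring lra zify.
Set Implicit Arguments. Unset Strict Implicit. Unset Printing Implicit Defensive.
Import Order.TTheory GRing.Theory Num.Theory.
Local Open Scope ring_scope.

(** * Bernstein polynomials *)

(** Independence is taken modulo constants because a perturbation must preserve the total mass.
    Three disjoint permutation matrices of size 3 add up to the all-one matrix, so the derivatives
    of 123, 231 and 312 are dependent; this is why orders at most 3 need an exact example, whereas
    from size 4 on each row has an entry missed by all three matrices. Different orders are
    separated by homogenizing: under x = z / (1 + z) a Bernstein polynomial of degree d becomes a
    monomial over (1 + z)^d, and after clearing denominators z = -1 leaves only the highest degree.
    Newton's method runs over the rationals, so that cell weights have a common denominator and
    sampling reduces to counting points. Its iterates need not converge there, but approximate
    solutions suffice: only limits of densities matter, and the excess of the last pattern does not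
    depend on the precision. Copies of patterns are only bounded from below; as the densities of one
    order add up to 1, such bounds become two-sided. *)

Definition bern (F : pzRingType) (d i : nat) (x : F) : F :=
  x ^+ i * (1 - x) ^+ (d - i) *+ 'C(d, i).

Section Bern.
Variable F : numFieldType.

Lemma bern_at0 d i : bern d i (0 : F) = (i == 0%N)%:R.
Proof.
rewrite /bern subr0 expr1n mulr1 expr0n.
by case: i => [|i] /=; rewrite ?bin0 ?mul0rn.
Qed.

Lemma bern_rev d i (x : F) : (i <= d)%N -> bern d (d - i) x = bern d i (1 - x).
Proof. by move=> le_id; rewrite /bern bin_sub // subKn // subKr mulrC. Qed.

Lemma bern_homog d i (z : F) : (i <= d)%N -> 1 + z != 0 ->
  bern d i (z / (1 + z)) * (1 + z) ^+ d = z ^+ i *+ 'C(d, i).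
Proof.
move=> le_id nz; rewrite /bern.
have -> : 1 - z / (1 + z) = (1 + z)^-1.
  by rewrite -[X in X - _](divff nz) -mulrBl addrK div1r.
rewrite mulrnAl; congr (_ *+ _).
rewrite expr_div_n exprVn -{2}(subnK le_id) exprD.
have h1 : (1 + z) ^+ i != 0 by rewrite expf_neq0.
have h2 : (1 + z) ^+ (d - i) != 0 by rewrite expf_neq0.
by rewrite -!mulrA mulKf // mulVf // mulr1.
Qed.

Lemma poly_nat_eq0 (p : {poly F}) : (forall n : nat, p.[n%:R] = 0) -> p = 0.
Proof.
move=> h; apply: (@roots_geq_poly_eq0 _ p [seq n%:R | n <- iota 0 (size p)]).
- by apply/allP => x /mapP[n _ ->]; rewrite rootE h.
- rewrite map_inj_uniq ?iota_uniq //.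
  by move=> i j /eqP; rewrite eqr_nat => /eqP.
- by rewrite size_map size_iota.
Qed.

(** Substituting [x = z / (1 + z)] and multiplying by [(1 + z) ^ D] clears denominators, and
    agreement at all natural [z] makes the identity formal. It can then be used at [z = -1], which
    corresponds to no [x]. An entry of [r] consists of a coefficient, a degree and an index. *)
Lemma bern_homog_poly (r : seq (F * nat * nat)) (c : F) (D : nat) :
  all (fun t => t.2 <= t.1.2 <= D)%N r ->
  (forall x : F, \sum_(t <- r) t.1.1 * bern t.1.2 t.2 x = c) ->
  \sum_(t <- r) (t.1.1 *+ 'C(t.1.2, t.2)) *: ('X ^+ t.2 * (1 + 'X) ^+ (D - t.1.2))
    = c *: (1 + 'X) ^+ D.
Proof.
move=> /allP hr h; apply/eqP; rewrite -subr_eq0; apply/eqP/poly_nat_eq0 => n.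
have nz : 1 + n%:R != 0 :> F by rewrite -[1]/(1%:R) -natrD pnatr_eq0.
rewrite hornerD hornerN horner_sum hornerZ -(h (n%:R / (1 + n%:R))).
rewrite horner_exp hornerD hornerC hornerX mulr_suml.
apply/eqP; rewrite subr_eq0; apply/eqP.
rewrite big_seq_cond [RHS]big_seq_cond; apply: eq_bigr => t /andP[/hr/andP[le_ed le_dD] _].
rewrite hornerZ hornerM !horner_exp hornerD hornerC hornerX.
set N := n%:R in nz *.
have -> : (1 + N) ^+ D = (1 + N) ^+ t.1.2 * (1 + N) ^+ (D - t.1.2).
  by rewrite -exprD subnKC.
by rewrite [RHS]mulrA -[X in _ = X * _]mulrA bern_homog // mulrnAr -mulrnAl mulrA.
Qed.

Lemma sum_bern d (x : F) : \sum_(i < d.+1) bern d i x = 1.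
Proof.
rewrite -[RHS](expr1n _ d) -[in RHS](subrK x 1) exprDn.
by apply: eq_bigr => i _; rewrite /bern mulrC.
Qed.

(** Since the [bern d i] sum to 1, subtracting [c] from every coefficient leaves a vanishing
    combination, whose homogenization is a combination of the monomials [z ^ i]. *)
Lemma bern_free d (a : 'I_d.+1 -> F) (c : F) :
  (forall x : F, \sum_(i < d.+1) a i * bern d i x = c) -> forall i, a i = c.
Proof.
move=> h i.
pose r := [seq (a j - c, d, nat_of_ord j) | j <- index_enum 'I_d.+1].
have hp := @bern_homog_poly r 0 d; rewrite scale0r !big_map /= in hp.
have {}hp : \sum_(j < d.+1) ((a j - c) *+ 'C(d, j)) *: ('X^j * (1 + 'X) ^+ (d - d)) = 0 :> {poly F}.
  apply: hp => [|x].
    by apply/allP => _ /mapP[j _ ->] /=; rewrite leqnn -ltnS ltn_ord.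
  rewrite big_map /=; under eq_bigr do rewrite mulrBl.
  by rewrite sumrB h -mulr_sumr sum_bern mulr1 subrr.
have := congr1 (fun p : {poly F} => p`_i) hp.
rewrite coef0 coef_sum (bigD1 i) //= big1 ?addr0.
  rewrite subnn mulr1 coefZ coefXn eqxx mulr1 => /eqP.
  rewrite mulrn_eq0 -leqn0 leqNgt bin_gt0 -ltnS ltn_ord /= subr_eq0.
  by move/eqP.
move=> j neq; rewrite subnn mulr1 coefZ coefXn; case: eqP => [eq|]; rewrite ?mulr0 //.
by case/eqP: neq; apply: val_inj; rewrite /= eq.
Qed.

Lemma avoid_nat (s : seq nat) D : (size s <= D)%N -> exists2 l, (l <= D)%N & l \notin s.
Proof.
move=> hs; have [/allP h|/allPn[l hl nl]] := boolP (all (mem s) (iota 0 D.+1)).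
  by have := uniq_leq_size (iota_uniq 0 D.+1) h; rewrite size_iota ltnNge hs.
by exists l => //; move: hl; rewrite mem_iota add0n ltnS.
Qed.

Lemma coef_exp1X n l : ((1 + 'X) ^+ n : {poly F})`_l = 'C(n, l)%:R.
Proof.
elim: n l => [|n IH] l; first by rewrite expr0 coef1 bin0n.
rewrite exprS mulrDl mul1r coefD coefXM IH.
by case: l => [|l] /=; rewrite ?bin0 ?addr0 // IH binS natrD addrC addrC.
Qed.

(** This is the shape of a relation between gradients on a side of the square. Only degrees
    differing by one can balance. Then the first term meets the consecutive powers [z ^ p] and
    [z ^ p.+1], with weights proportional to [D - p] and [p.+1] relative to the binomials of [D],
    and comparing these two coefficients forces the weights to agree. *)
Lemma side_relation (a1 a2 a3 c : F) d p D j k :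
  (0 < d < D)%N -> (3 <= D)%N -> (p <= d)%N -> (j <= D)%N -> (k <= D)%N ->
  `|a2| = `|a3| -> a1 != 0 ->
  (forall x, a1 * bern d p x + a2 * bern D j x + a3 * bern D k x = c) ->
  D = p.*2.+1.
Proof.
move=> /andP[d0 dD] D3 pd jD kD h23 a1N0 h.
have Cj : 'C(D, j)%:R != 0 :> F by rewrite pnatr_eq0 -lt0n bin_gt0.
have Ck : 'C(D, k)%:R != 0 :> F by rewrite pnatr_eq0 -lt0n bin_gt0.
have hp := @bern_homog_poly [:: (a1, d, p); (a2, D, j); (a3, D, k)] c D.
have {}hp : (a1 *+ 'C(d, p)) *: ('X^p * (1 + 'X) ^+ (D - d)) + (a2 *+ 'C(D, j)) *: 'X^j
    + (a3 *+ 'C(D, k)) *: 'X^k = c *: (1 + 'X) ^+ D.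
  rewrite -hp => [| |x]; last by rewrite !big_cons big_nil addr0 /= addrA.
    by rewrite !big_cons big_nil /= subnn expr0 !mulr1 addr0 addrA.
  by rewrite /= pd (ltnW dD) jD kD leqnn.
have not_cst : ~ (forall x, a1 * bern d p x = c).
  move=> hc.
  have hf : forall i : 'I_d.+1, a1 *+ (i == p :> nat) = c.
    apply: bern_free => x; rewrite -[RHS](hc x).
    rewrite (bigD1 (Ordinal (pd : (p < d.+1)%N))) //= eqxx big1 ?addr0 // => i /eqP neq.
    case: eqP => [e|_]; last by rewrite mul0r.
    by case: neq; apply: val_inj.
  have [l ld] := @avoid_nat [:: p] d d0; rewrite inE => lp.
  have c0 := hf (Ordinal (ld : (l < d.+1)%N)); rewrite /= (negPf lp) in c0.
  have := hf (Ordinal (pd : (p < d.+1)%N)); rewrite /= eqxx -c0 => /eqP.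
  by rewrite (negPf a1N0).
(* If the degrees differ by at least two, the first term and the constant vanish to second order at
   [z = -1]. So do the two remaining monomials together, which is only possible if they cancel. *)
have [e2|] := leqP 2 (D - d).
  case: not_cst => x.
  suff : a2 * bern D j x + a3 * bern D k x = 0.
    by move=> e; rewrite -[RHS](h x) -addrA e addr0.
  have v0 := congr1 (fun q : {poly F} => q.[-1]) hp.
  have v1 := congr1 (fun q : {poly F} => q^`().[-1]) hp.
  have sgnP n : (-1) ^+ n.-1 *+ n = - ((-1) ^+ n *+ n) :> F.
    by case: n => [|n] /=; rewrite ?mulr0n ?oppr0 // exprS mulN1r mulNrn opprK.
  have U0 n : (1 < n)%N -> ((1 + 'X) ^+ n : {poly F}).[-1] = 0.
    by case: n => // n _; rewrite horner_exp hornerD hornerC hornerX subrr expr0n.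
  have U1 n : (1 < n)%N -> ((1 + 'X) ^+ n : {poly F})^`().[-1] = 0.
    move=> n1; rewrite deriv_exp hornerMn hornerM horner_exp.
    by rewrite !hornerD hornerC hornerX subrr expr0n; case: n n1 => [|[]] // n _; rewrite mulr0 mul0rn.
  have D1 : (1 < D)%N := ltnW D3.
  move: v0 v1; rewrite !derivD !derivZ derivM !derivXn.
  rewrite !(hornerD, hornerZ, hornerM) !U0 // !U1 // !hornerMn !hornerXn.
  rewrite !(mulr0, add0r, addr0).
  rewrite !sgnP !mulrN => v0 v1.
  have sN n : (-1) ^+ n != 0 :> F by rewrite signr_eq0.
  have [jk|jk] := eqVneq j k.
    move: v0; rewrite -jk -mulrDl -mulrnDl => /eqP.
    rewrite mulf_eq0 (negPf (sN _)) orbF -mulr_natr mulf_eq0 (negPf Cj) orbF => /eqP a23.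
    by rewrite -mulrDl a23 mul0r.
  have a20 : a2 = 0.
    have : a2 * ('C(D, j)%:R * (-1) ^+ j * (j%:R - k%:R)) = 0.
      transitivity (- (- (a2 *+ 'C(D, j) * ((-1) ^+ j *+ j))
          - a3 *+ 'C(D, k) * ((-1) ^+ k *+ k))
        - k%:R * (a2 *+ 'C(D, j) * (-1) ^+ j + a3 *+ 'C(D, k) * (-1) ^+ k)); first ring.
      by rewrite v1 v0 mulr0 !oppr0 addr0.
    move/eqP; rewrite !mulf_eq0 (negPf Cj) (negPf (sN _)) subr_eq0 eqr_nat (negPf jk) !orbF.
    by move/eqP.
  move/eqP: v0; rewrite a20 mul0rn mul0r add0r mulf_eq0 (negPf (sN _)) orbF -mulr_natr.
  by rewrite mulf_eq0 (negPf Ck) orbF => /eqP->; rewrite !mul0r addr0.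
rewrite ltnS leq_eqVlt ltnS leqn0 subn_eq0 leqNgt dD orbF => /eqP Dd.
have {}Dd : D = d.+1 by lia.
have hl l : a1 *+ 'C(d, p) * ((l == p)%:R + (l == p.+1)%:R)
    + (a2 *+ (l == j) + a3 *+ (l == k)) * 'C(D, l)%:R = c * 'C(D, l)%:R.
  have := congr1 (fun q : {poly F} => q`_l) hp.
  rewrite !coefD !coefZ coef_exp1X Dd subSnn expr1 mulrDr mulr1 -exprSr coefD !coefXn -Dd.
  move=> <-; rewrite -addrA; congr (_ + _); rewrite mulrDl; congr (_ + _).
    by rewrite !mulr_natr -!mulrnA; case: eqP => [->|_]; rewrite ?muln1 ?mul1n ?muln0.
  by rewrite !mulr_natr -!mulrnA; case: eqP => [->|_]; rewrite ?muln1 ?mul1n ?muln0.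
have pD : (p < D)%N by rewrite Dd.
have hlo l : (l <= D)%N -> l != p -> l != p.+1 -> a2 *+ (l == j) + a3 *+ (l == k) = c.
  move=> lD /negPf lp /negPf lp1; have := hl l; rewrite lp lp1 addr0 mulr0 add0r => /mulIf; apply.
  by rewrite pnatr_eq0 -lt0n bin_gt0.
have Cp : 'C(D, p)%:R != 0 :> F by rewrite pnatr_eq0 -lt0n bin_gt0 ltnW.
have Cp1 : 'C(D, p.+1)%:R != 0 :> F by rewrite pnatr_eq0 -lt0n bin_gt0.
have hlp : a1 * (D - p)%:R + D%:R * (a2 *+ (p == j) + a3 *+ (p == k)) = D%:R * c.
  have e1 : D%:R * 'C(d, p)%:R = (D - p)%:R * 'C(D, p)%:R :> F.
    by rewrite -!natrM; have := mul_bin_down D p; rewrite Dd /= => ->.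
  have := hl p; rewrite eqxx (ltn_eqF (ltnSn p)) addr0 mulr1 -(mulr_natr a1); set S := _ *+ _ + _ => e2.
  apply: (mulIf Cp).
  transitivity (a1 * ((D - p)%:R * 'C(D, p)%:R) + D%:R * (S * 'C(D, p)%:R)); first ring.
  rewrite -e1; transitivity (D%:R * (a1 * 'C(d, p)%:R + S * 'C(D, p)%:R)); first ring.
  by rewrite e2 mulrA.
have hlp1 : a1 * p.+1%:R + D%:R * (a2 *+ (p.+1 == j) + a3 *+ (p.+1 == k)) = D%:R * c.
  have e1 : D%:R * 'C(d, p)%:R = p.+1%:R * 'C(D, p.+1)%:R :> F.
    by rewrite -!natrM; have := mul_bin_diag D p; rewrite Dd /= => ->.
  have := hl p.+1; rewrite eqxx (gtn_eqF (ltnSn p)) add0r mulr1 -(mulr_natr a1); set S := _ *+ _ + _ => e2.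
  apply: (mulIf Cp1).
  transitivity (a1 * (p.+1%:R * 'C(D, p.+1)%:R) + D%:R * (S * 'C(D, p.+1)%:R)); first ring.
  rewrite -e1; transitivity (D%:R * (a1 * 'C(d, p)%:R + S * 'C(D, p.+1)%:R)); first ring.
  by rewrite e2 mulrA.
have DN0 : D%:R != 0 :> F by rewrite pnatr_eq0; lia.
have DpN0 : (D - p)%:R != 0 :> F by rewrite pnatr_eq0; lia.
have p1N0 : p.+1%:R != 0 :> F by rewrite pnatr_eq0.
(* An index outside [p], [p.+1], [j], [k] carries only the constant; one exists in [0..D] as soon as
   these four are covered by a list of at most [D] entries. *)
have c0 s : (size s <= D)%N -> {subset [:: p; p.+1; j; k] <= s} -> c = 0.
  move=> hs sub; have [l lD ls] := avoid_nat hs.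
  have nl x : x \in [:: p; p.+1; j; k] -> l != x.
    by move=> /sub xs; apply: contraNneq ls => ->.
  by rewrite -(hlo l lD) ?nl ?inE ?eqxx ?orbT // !(negPf (nl _ _)) ?inE ?eqxx ?orbT // !mulr0n addr0.
have eqD : (D - p)%:R = p.+1%:R :> F -> D = p.*2.+1.
  by move=> /eqP; rewrite eqr_nat => /eqP; lia.
(* If both [p] and [p.+1] are among [j], [k], then [c = 0] and [h23] compares the two weights in
   absolute value. If exactly one is, the equation at the other reads [a1] times a nonzero weight
   equals 0. If neither is, both equations have the same right side. *)
have [] := boolP (p \in [:: j; k]); have [] := boolP (p.+1 \in [:: j; k]).
- move=> p1jk pjk.
  have c_0 : c = 0.
    apply: (c0 [:: j; k]) => [|x]; first exact: ltnW.
    by rewrite [x \in _]inE => /predU1P[-> //|]; rewrite inE => /predU1P[->|].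
  apply: eqD; have nN : `|a1| != 0 by rewrite normr_eq0.
  have nrm x y : a1 * x%:R + D%:R * y = D%:R * c -> `|a1| * x%:R = D%:R * `|y|.
    rewrite c_0 mulr0 => /eqP; rewrite addr_eq0 => /eqP /(congr1 Num.norm).
    by rewrite normrN !normrM !normr_nat.
  move: hlp hlp1 => /nrm + /nrm.
  move: p1jk pjk; rewrite !inE => /orP[]/eqP e1 /orP[]/eqP e2; move: (e1) (e2) => e1' e2'.
  - by move: (ltnSn p); rewrite {1}e2 e1 ltnn.
  - rewrite -e1 -e2 eqxx (ltn_eqF (ltnSn p)) (gtn_eqF (ltnSn p)) eqxx.
    by rewrite !mulr0n add0r addr0 -h23 => <- /(mulfI nN).
  - rewrite -e1 -e2 eqxx (ltn_eqF (ltnSn p)) (gtn_eqF (ltnSn p)) eqxx.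
    by rewrite !mulr0n add0r addr0 -h23 => <- /(mulfI nN).
  - by move: (ltnSn p); rewrite {1}e2 e1 ltnn.
- move=> p1jk pjk; exfalso.
  have c_0 : c = 0.
    by apply: (c0 [:: p.+1; j; k]) => // x; rewrite inE => /predU1P[->|//]; rewrite inE pjk orbT.
  move: p1jk hlp1; rewrite !inE negb_or => /andP[/negPf-> /negPf->].
  rewrite c_0 !mulr0n addr0 !mulr0 addr0 => /eqP.
  by rewrite mulf_eq0 (negPf a1N0) (negPf p1N0).
- move=> p1jk pjk; exfalso.
  have c_0 : c = 0.
    apply: (c0 [:: p; j; k]) => // x; rewrite !inE => /or4P[] /eqP->; rewrite ?eqxx ?orbT //.
    by move: p1jk; rewrite !inE => ->; rewrite orbT.
  move: pjk hlp; rewrite !inE negb_or => /andP[/negPf-> /negPf->].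
  rewrite c_0 !mulr0n addr0 !mulr0 addr0 => /eqP.
  by rewrite mulf_eq0 (negPf a1N0) (negPf DpN0).
- rewrite !inE !negb_or => /andP[/negPf e1 /negPf e2] /andP[/negPf e3 /negPf e4].
  move: hlp hlp1; rewrite e1 e2 e3 e4 !mulr0n addr0 !mulr0 !addr0 => <- /(mulfI a1N0) e.
  exact/eqD.
Qed.

End Bern.

(** * Linear independence of the derivatives *)

(* Up to the factor k^2, this is the derivative at the uniform measure of k! times the density of p,
   in the direction of a unit mass at (x, y). *)
Definition grad (F : pzRingType) (p : perm_t) (x y : F) : F :=
  \sum_(i < tag p) bern (tag p).-1 i x * bern (tag p).-1 (tagged p i) y.

Definition mkp k (s : 'S_k) : perm_t := Tagged (fun k : nat => 'S_k) s.

Section Indep.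
Variable F : numFieldType.
Implicit Types (x y c : F).

(* linear independence modulo constants *)
Definition indep (l : seq perm_t) := forall (a : perm_t -> F) c,
  (forall x y, \sum_(p <- l) a p * grad p x y = c) -> {in l, forall p, a p = 0}.

Lemma bern_at1 d i : (i <= d)%N -> bern d i (1 : F) = (i == d)%:R.
Proof.
move=> le_id; have := bern_rev (0 : F) le_id.
by rewrite subr0 => <-; rewrite bern_at0 subn_eq0 eqn_leq le_id.
Qed.

Section SameOrder.
Variable d : nat.
Implicit Types s : 'S_d.+1.

Lemma grad0l s y : grad (mkp s) 0 y = bern d (s ord0) y.
Proof.
rewrite /grad /= (bigD1 ord0) //= bern_at0 mul1r big1 ?addr0 // => i.
by rewrite bern_at0 -val_eqE /= => /negPf->; rewrite mul0r.
Qed.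

Lemma grad1l s y : grad (mkp s) 1 y = bern d (s ord_max) y.
Proof.
rewrite /grad /= (bigD1 ord_max) //= bern_at1 // eqxx mul1r big1 ?addr0 // => i.
by rewrite bern_at1 ?leq_ord // -val_eqE /= => /negPf->; rewrite mul0r.
Qed.

Lemma grad0r s x : grad (mkp s) x 0 = bern d (s^-1%g ord0) x.
Proof.
rewrite /grad /= (bigD1 (s^-1%g ord0)) //= permKV bern_at0 mulr1 big1 ?addr0 // => i ne.
rewrite bern_at0 -[0%N]/(val (@ord0 d)) val_eqE (can2_eq (permK s) (permKV s)).
by rewrite (negPf ne) mulr0.
Qed.

(** The products of Bernstein polynomials in [x] and in [y] are independent, so the relation says
    that a combination of permutation matrices equals [c] times the all-one matrix. *)
Lemma same_order_matrix (I : Type) (r : seq I) (s : I -> 'S_d.+1) (a : I -> F) c :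
  (forall x y, \sum_(t <- r) a t * grad (mkp (s t)) x y = c) ->
  forall i j, \sum_(t <- r) a t *+ (s t i == j) = c.
Proof.
move=> h i j.
have hj x : \sum_(t <- r) a t * bern d ((s t)^-1%g j) x = c.
  apply: (bern_free (a := fun j => \sum_(t <- r) a t * bern d ((s t)^-1%g j) x)) => y.
  rewrite -[RHS](h x y).
  under eq_bigr do rewrite mulr_suml; rewrite exchange_big /=; apply: eq_bigr => t _.
  rewrite /grad /= mulr_sumr (reindex_inj (@perm_inj _ (s t))) /=.
  by apply: eq_bigr => k _; rewrite permK mulrA.
apply: (bern_free (a := fun i => \sum_(t <- r) a t *+ (s t i == j))) => x.
rewrite -[RHS](hj x); under eq_bigr do rewrite mulr_suml; rewrite exchange_big /=.
apply: eq_bigr => t _; rewrite (bigD1 ((s t)^-1%g j)) //= permKV eqxx big1 ?addr0 // => k ne.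
by rewrite (can2_eq (permK (s t)) (permKV (s t))) (negPf ne) mul0r.
Qed.

Lemma same_order2 s1 s2 a1 a2 c : (2 <= d)%N -> s1 != s2 ->
  (forall x y, a1 * grad (mkp s1) x y + a2 * grad (mkp s2) x y = c) ->
  a1 = 0 /\ a2 = 0.
Proof.
move=> d2 ne h.
have hm i j : a1 *+ (s1 i == j) + a2 *+ (s2 i == j) = c.
  have := @same_order_matrix _ [:: (a1, s1); (a2, s2)] snd fst c _ i j.
  rewrite !big_cons !big_nil addr0; apply => x y.
  by rewrite !big_cons !big_nil addr0.
have c0 : c = 0.
  have [l ld] := @avoid_nat [:: val (s1 ord0); val (s2 ord0)] d d2.
  rewrite !inE negb_or => /andP[n1 n2].
  have := hm ord0 (Ordinal (ld : (l < d.+1)%N)).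
  by rewrite -!val_eqE /= ![_ == l]eq_sym (negPf n1) (negPf n2) addr0.
have [i ni] : exists i, s1 i != s2 i.
  apply/existsP; apply: contraNT ne => /existsPn h'; apply/eqP/permP => i.
  by have := h' i; rewrite negbK => /eqP.
split.
  by have := hm i (s1 i); rewrite eqxx eq_sym (negPf ni) addr0 c0.
by have := hm i (s2 i); rewrite eqxx (negPf ni) add0r c0.
Qed.

(** A row has at least four entries, one of them missed by all three permutations, whence [c = 0].
    At order 3 this fails for three disjoint permutation matrices. *)
Lemma same_order3 s1 s2 s3 a1 a2 a3 c :
  (3 <= d)%N -> s1 != s2 -> s1 != s3 -> s2 != s3 ->
  (forall x y, a1 * grad (mkp s1) x y + a2 * grad (mkp s2) x y + a3 * grad (mkp s3) x y = c) ->
  [/\ a1 = 0, a2 = 0 & a3 = 0].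
Proof.
move=> d3 n12 n13 n23 h.
have hm i j : a1 *+ (s1 i == j) + a2 *+ (s2 i == j) + a3 *+ (s3 i == j) = c.
  have := @same_order_matrix _ [:: (a1, s1); (a2, s2); (a3, s3)] snd fst c _ i j.
  rewrite !big_cons !big_nil addr0 addrA; apply => x y.
  by rewrite !big_cons !big_nil addr0 addrA.
have c0 : c = 0.
  have [l ld] := @avoid_nat [:: val (s1 ord0); val (s2 ord0); val (s3 ord0)] d d3.
  rewrite !inE !negb_or => /and3P[n1 n2 n3].
  have := hm ord0 (Ordinal (ld : (l < d.+1)%N)).
  by rewrite -!val_eqE /= ![_ == l]eq_sym (negPf n1) (negPf n2) (negPf n3) !addr0.
have h2 := same_order2 (ltnW d3).
have [a10|a1N0] := eqVneq a1 0.
  have [x y|-> -> //] := h2 _ _ a2 a3 c n23.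
  by rewrite -(h x y) a10 mul0r add0r.
have [a20|a2N0] := eqVneq a2 0.
  have [x y|-> -> //] := h2 _ _ a1 a3 c n13.
  by rewrite -(h x y) a20 mul0r addr0.
have [i ni] : exists i, s1 i != s2 i.
  apply/existsP; apply: contraNT n12 => /existsPn h'; apply/eqP/permP => i.
  by have := h' i; rewrite negbK => /eqP.
(* With nonzero [a1] and [a2], the entries [s1 i] and [s2 i] of row [i] must both be cancelled by
   [s3], which has a single entry there. *)
have := hm i (s1 i); have := hm i (s2 i).
rewrite !eqxx [s2 i == _]eq_sym !(negPf ni) c0 add0r addr0.
case: eqP => [e3 _|_ /eqP]; last by rewrite addr0 (negPf a2N0).
by rewrite e3 eq_sym (negPf ni) addr0 => /eqP; rewrite (negPf a1N0).
Qed.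

End SameOrder.

Section MixedOrder.
Variables (d D : nat) (s1 : 'S_d.+1) (s2 s3 : 'S_D.+1) (a1 a2 a3 c : F).
Hypothesis h : forall x y,
  a1 * grad (mkp s1) x y + a2 * grad (mkp s2) x y + a3 * grad (mkp s3) x y = c.
Hypothesis d_gt0 : (0 < d)%N.
Hypothesis ltdD : (d < D)%N.

(* x = z / (1 + z) turns bern D i x into z^i / (1 + z)^D; at z = -1 only the top order survives. *)
Lemma mixed_order_norm : `|a2| = `|a3|.
Proof.
have D0 : (0 < D)%N := ltn_trans d_gt0 ltdD.
have hy y : \sum_(i < D.+1) (a2 * bern D (s2 i) y + a3 * bern D (s3 i) y) *+ 'C(D, i) * (-1) ^+ i = 0.
  pose r := [seq (a1 * bern d (s1 i) y, d, nat_of_ord i) | i <- index_enum 'I_d.+1]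
    ++ [seq (a2 * bern D (s2 i) y + a3 * bern D (s3 i) y, D, nat_of_ord i) | i <- index_enum 'I_D.+1].
  have hp := @bern_homog_poly F r c D.
  have {}hp : \sum_(t <- r) (t.1.1 *+ 'C(t.1.2, t.2)) *: ('X ^+ t.2 * (1 + 'X) ^+ (D - t.1.2))
    = c *: (1 + 'X) ^+ D :> {poly F}.
    apply: hp => [|x].
      rewrite all_cat; apply/andP; split; apply/allP => _ /mapP[j _ ->] /=.
        by rewrite leq_ord ltnW.
      by rewrite leq_ord leqnn.
    rewrite big_cat !big_map /= -[RHS](h x y) -addrA; congr (_ + _).
      by rewrite /grad /= mulr_sumr; apply: eq_bigr => i _; rewrite -mulrA [bern d i x * _]mulrC.
    rewrite /grad /= !mulr_sumr -big_split /=; apply: eq_bigr => i _.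
    by rewrite mulrDl -!mulrA ![bern D i x * _]mulrC.
  have U0 n : (0 < n)%N -> ((1 + 'X) ^+ n : {poly F}).[-1] = 0.
    by case: n => // n _; rewrite horner_exp hornerD hornerC hornerX subrr expr0n.
  move/(congr1 (fun q : {poly F} => q.[-1])): hp.
  rewrite hornerZ U0 // mulr0 horner_sum big_cat !big_map /= big1 ?add0r => [hp|i _].
    by rewrite -[RHS]hp; apply: eq_bigr => i _; rewrite subnn expr0 mulr1 hornerZ hornerXn.
  by rewrite hornerZ hornerM U0 ?mulr0 ?subn_gt0.
pose b a (s : 'S_D.+1) j : F := a * (-1) ^+ (s^-1%g j) *+ 'C(D, s^-1%g j).
have hj j : b a2 s2 j + b a3 s3 j = 0.
  apply: (bern_free (a := fun j => b a2 s2 j + b a3 s3 j)) => y; rewrite -[RHS](hy y).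
  under eq_bigr do rewrite mulrDl; rewrite big_split /=.
  rewrite (reindex_inj (@perm_inj _ s2)) [X in _ + X](reindex_inj (@perm_inj _ s3)) /=.
  rewrite -big_split /=; apply: eq_bigr => i _; rewrite /b !permK.
  by ring.
have nb a (s : 'S_D.+1) j : `|b a s j| = `|a| *+ 'C(D, s^-1%g j).
  by rewrite /b normrMn normrM normrX normrN1 expr1n mulr1.
(* Summing absolute values over [j] removes the permutation and leaves the binomial total
   [2 ^ D]. *)
have sumC (s : 'S_D.+1) a : \sum_j `|b a s j| = `|a| * (2 ^ D)%:R.
  under eq_bigr do rewrite nb; rewrite (reindex_inj (@perm_inj _ s)) /=.
  under eq_bigr do rewrite permK -mulr_natr; rewrite -mulr_sumr -natr_sum; congr (_ * _%:R).
  have := expnDn 1 1 D; rewrite addn1 => ->.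
  by apply: eq_bigr => i _; rewrite !exp1n !muln1.
have : \sum_j `|b a2 s2 j| = \sum_j `|b a3 s3 j|.
  by apply: eq_bigr => j _; move/eqP: (hj j); rewrite addr_eq0 => /eqP->; rewrite normrN.
rewrite !sumC => /mulIf; apply.
by rewrite pnatr_eq0 -lt0n expn_gt0.
Qed.

(** By [side_relation] on the sides [x = 0] and [x = 1], both end values of [s1] would be the middle
    index [(D - 1) / 2], contradicting injectivity since [0 < d]. *)
Lemma mixed_order_free : (3 <= D)%N -> s2 != s3 -> [/\ a1 = 0, a2 = 0 & a3 = 0].
Proof.
move=> D3 n23; have [a10|a1N0] := eqVneq a1 0.
  have [x y|-> -> //] := same_order2 (ltnW D3) n23 (a1 := a2) (a2 := a3) (c := c).
  by rewrite -(h x y) a10 mul0r add0r.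
have side (i : 'I_d.+1) (j k : 'I_D.+1) :
  (forall y, a1 * bern d i y + a2 * bern D j y + a3 * bern D k y = c) -> D = i.*2.+1.
  move=> hy; apply: side_relation hy => //; rewrite ?d_gt0 ?leq_ord //.
  exact: mixed_order_norm.
have e0 : D = (s1 ord0).*2.+1.
  by apply: side => y; rewrite -[RHS](h 0 y) !grad0l.
have e1 : D = (s1 ord_max).*2.+1.
  by apply: side => y; rewrite -[RHS](h 1 y) !grad1l.
have : s1 ord0 = s1 ord_max by apply: val_inj; apply: double_inj; move: e0; rewrite {1}e1 => -[].
by move/perm_inj/(congr1 val) => /= d0; have := d_gt0; rewrite -d0.
Qed.

End MixedOrder.

(** The preimage of the value 0, as a natural number so that patterns of different orders fit in one
    list. The default is only met at order 0. *)
Definition lowpos (p : perm_t) : nat :=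
  if [pick i : 'I_(tag p) | tagged p i == 0%N :> nat] is Some i then val i else 0%N.

Lemma grad_low p x : (0 < tag p)%N ->
  (lowpos p <= (tag p).-1)%N /\ grad p x 0 = bern (tag p).-1 (lowpos p) x.
Proof.
case: p => -[|d] s //= _; rewrite /lowpos /=.
have e : s (s^-1%g ord0) = ord0 by rewrite permKV.
case: pickP => [i /eqP/= si|/(_ (s^-1%g ord0))]; last by rewrite e.
have -> : i = s^-1%g ord0 by apply: (perm_inj (s := s)); rewrite e; apply: val_inj.
by rewrite leq_ord; split=> //; apply: (grad0r s).
Qed.

(** On the side [y = 0] every gradient is a single Bernstein polynomial. After homogenizing to the
    positive degree [(tag p).-1], the value at [z = -1] kills the constant and all smaller orders,
    leaving a nonzero multiple of [a p]. *)
Lemma indep_cons p l : (2 <= porder p)%N -> (forall q, q \in l -> 0 < porder q < porder p)%N ->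
  indep l -> indep (p :: l).
Proof.
rewrite /porder => p2 hl il a c h.
have p0 : (0 < tag p)%N := ltnW p2.
have ap0 : a p = 0.
  pose r := [seq (a q, (tag q).-1, lowpos q) | q <- p :: l].
  have hp := @bern_homog_poly F r c (tag p).-1.
  have {}hp : \sum_(t <- r) (t.1.1 *+ 'C(t.1.2, t.2)) *: ('X ^+ t.2 * (1 + 'X) ^+ ((tag p).-1 - t.1.2))
    = c *: (1 + 'X) ^+ (tag p).-1 :> {poly F}.
    apply: hp => [|x].
      apply/allP => _ /mapP[q ql ->] /=.
      move: ql; rewrite inE => /predU1P[->|/hl/andP[q0 qp]].
        by rewrite leqnn andbT (grad_low 0 p0).1.
      by rewrite (grad_low 0 q0).1 -!subn1 leq_sub2r // ltnW.
    rewrite big_map /= -[RHS](h x 0) big_seq [RHS]big_seq; apply: eq_bigr => q ql.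
    rewrite (grad_low x _).2 //.
    by move: ql; rewrite inE => /predU1P[->|/hl/andP[]].
  have U0 n : (0 < n)%N -> ((1 + 'X) ^+ n : {poly F}).[-1] = 0.
    by case: n => // n _; rewrite horner_exp hornerD hornerC hornerX subrr expr0n.
  move/(congr1 (fun q : {poly F} => q.[-1])): hp.
  rewrite hornerZ U0; last lia.
  rewrite mulr0 horner_sum big_map big_cons /= subnn expr0 mulr1 hornerZ hornerXn.
  rewrite big_seq big1 ?addr0 => [/eqP|q /hl/andP[q0 qp]].
    rewrite mulf_eq0 signr_eq0 orbF mulrn_eq0 -leqn0 leqNgt bin_gt0.
    by rewrite (grad_low 0 p0).1 => /eqP.
  by rewrite hornerZ hornerM U0 ?mulr0 // subn_gt0 -ltnS !prednK.
move=> q; rewrite inE => /predU1P[->//|]; apply: (il a c) => x y.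
by rewrite -(h x y) big_cons ap0 mul0r add0r.
Qed.

Lemma indep_same2 d (s1 s2 : 'S_d.+1) : (2 <= d)%N -> s1 != s2 -> indep [:: mkp s1; mkp s2].
Proof.
move=> d2 ne a c h p.
have [x y|e1 e2] := same_order2 d2 ne (a1 := a (mkp s1)) (a2 := a (mkp s2)) (c := c).
  by rewrite -(h x y) !big_cons big_nil addr0.
by rewrite !inE => /orP[]/eqP->.
Qed.

Lemma indep_same3 d (s1 s2 s3 : 'S_d.+1) : (3 <= d)%N -> s1 != s2 -> s1 != s3 -> s2 != s3 ->
  indep [:: mkp s1; mkp s2; mkp s3].
Proof.
move=> d3 n12 n13 n23 a c h p.
have [x y|e1 e2 e3] := same_order3 d3 n12 n13 n23 (a1 := a (mkp s1)) (a2 := a (mkp s2))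
  (a3 := a (mkp s3)) (c := c).
  by rewrite -(h x y) !big_cons big_nil addr0 addrA.
by rewrite !inE => /or3P[]/eqP->.
Qed.

Lemma indep_mixed d D (s1 : 'S_d.+1) (s2 s3 : 'S_D.+1) : (0 < d < D)%N -> (3 <= D)%N -> s2 != s3 ->
  indep [:: mkp s1; mkp s2; mkp s3].
Proof.
move=> /andP[d0 dD] D3 n23 a c h p.
have [x y|e1 e2 e3] := @mixed_order_free d D s1 s2 s3 (a (mkp s1)) (a (mkp s2))
  (a (mkp s3)) c _ d0 dD D3 n23.
  by rewrite -(h x y) !big_cons big_nil addr0 addrA.
by rewrite !inE => /or3P[]/eqP->.
Qed.

End Indep.

(** * Realizing point sets by permutations *)

Definition occ (p P : perm_t) : {set {set 'I_(tag P)}} :=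
  [set A : {set 'I_(tag P)} | (#|A| == tag p) && @occurs p P A].

(** The element [z] of [T] is a point at [(u z, v z)], and several points may share a coordinate.
    Strict inequalities make a copy survive any breaking of ties. *)
Definition forms (T : finType) (u v : T -> nat) (p : perm_t) (q : {ffun 'I_(tag p) -> T}) :=
  [forall i : 'I_(tag p), forall j : 'I_(tag p), ((i < j)%N ==> (u (q i) < u (q j))%N)
    && ((tagged p i < tagged p j)%N ==> (v (q i) < v (q j))%N)].

Lemma pat_valE (p : perm_t) (i : 'I_(tag p)) : pat_val p (val i) = val (tagged p i).
Proof. by rewrite /pat_val valK. Qed.

Section Rank.
Variables (T : finType) (u : T -> nat).

(** Ties in [u] are broken by the enumeration rank, which stays below [#|T|]. *)
Let key x := (u x * #|T| + enum_rank x)%N.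

Let key_inj : injective key.
Proof.
move=> x y e; apply: enum_rank_inj; apply: val_inj => /=.
have := congr1 (modn^~ #|T|) e.
by rewrite /key !modnMDl !modn_small.
Qed.

Let key_lt x y : (u x < u y)%N -> (key x < key y)%N.
Proof.
move=> lt; rewrite /key; apply: (@leq_trans ((u x).+1 * #|T|)).
  by rewrite mulSn addnC ltn_add2r.
by apply: leq_trans (leq_addr _ _); rewrite leq_mul2r lt orbT.
Qed.

Lemma ex_rank : exists r : T -> 'I_#|T|, injective r /\ forall x y, (u x < u y)%N -> (r x < r y)%N.
Proof.
have lt x : (#|[set y | (key y < key x)%N]| < #|T|)%N.
  rewrite -cardsT; apply: proper_card; apply/properP; split; first exact: finset.subsetT.
  by exists x; rewrite !inE ?ltnn.
have mono x y : (key x < key y)%N ->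
    (#|[set z | (key z < key x)%N]| < #|[set z | (key z < key y)%N]|)%N.
  move=> xy; apply: proper_card; apply/properP; split.
    by apply/fintype.subsetP => z; rewrite !inE => /ltn_trans; apply.
  by exists x; rewrite !inE ?ltnn.
exists (fun x => Ordinal (lt x)); split=> [x y /(congr1 val)/= e|x y /key_lt/mono //].
by apply: key_inj; case: (ltngtP (key x) (key y)) => // /mono; rewrite e ltnn.
Qed.

End Rank.

(** Breaking ties in both coordinates turns the points into a permutation. Tied points may create
    further copies, so the count is only a lower bound; [density_two_sided] makes up for this. *)
Lemma realize (T : finType) (u v : T -> nat) : exists P : perm_t, tag P = #|T| /\
  forall p, (#|[set q | forms u v (p := p) q]| <= #|occ p P|)%N.
Proof.
have [ru [ru_inj ru_lt]] := ex_rank u; have [rv [rv_inj rv_lt]] := ex_rank v.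
have iu : injective (fun i : 'I_#|T| => ru (enum_val i)).
  by move=> i j /ru_inj/enum_val_inj.
have iv : injective (fun i : 'I_#|T| => rv (enum_val i)).
  by move=> i j /rv_inj/enum_val_inj.
pose s := ((perm iu)^-1 * perm iv)%g.
have sE x : s (ru x) = rv x.
  have -> : ru x = perm iu (enum_rank x) by rewrite permE /= enum_rankK.
  by rewrite permM permK permE /= enum_rankK.
exists (mkp s); split=> // p; pose k := tag p.
pose A (q : {ffun 'I_k -> T}) : {set 'I_#|T|} := [set ru (q i) | i in 'I_k].
have sortA (q : {ffun 'I_k -> T}) : forms u v (p := p) q ->
  sort leq [seq val x | x <- enum (A q)] = [seq val (ru (q i)) | i <- enum 'I_k].
  move=> /forallP fq; apply: (@sorted_eq _ leq); first exact: leq_trans.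
  - exact: anti_leq.
  - by apply: sort_sorted; apply: leq_total.
  - rewrite sorted_map; apply: (@sub_sorted _ (relpre val ltn)).
      move=> i j /= ij; apply: ltnW; apply: ru_lt.
      by have /forallP/(_ j)/andP[/implyP/(_ ij)] := fq i.
    by rewrite -sorted_map val_enum_ord iota_ltn_sorted.
  - have -> : [seq val (ru (q i)) | i <- enum 'I_k] = [seq val x | x <- [seq ru (q i) | i <- enum 'I_k]].
      exact: (map_comp val (fun i => ru (q i))).
    rewrite perm_sort; apply: perm_map; apply: uniq_perm.
    + exact: enum_uniq.
    + rewrite map_inj_uniq; first exact: enum_uniq.
      move=> i j /ru_inj eq.
      case: (ltngtP i j) => [lt|lt|/val_inj//].
        by have /forallP/(_ j)/andP[/implyP/(_ lt)] := fq i; rewrite eq ltnn.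
      by have /forallP/(_ i)/andP[/implyP/(_ lt)] := fq j; rewrite eq ltnn.
    + move=> x; rewrite mem_enum; apply/imsetP/mapP => -[i hi ->]; exists i => //.
      by rewrite mem_enum.
(* A copy is recovered from its set of positions by sorting that set. *)
rewrite -(card_in_imset (f := A)); last first.
  move=> q q'; rewrite !inE => fq fq' e; have := sortA q fq; rewrite e sortA // => es.
  apply/ffunP => i; apply: ru_inj; apply: val_inj.
  have := congr1 (fun r => nth 0%N r i) es.
  by rewrite !(nth_map i) -?enumT ?size_enum_ord // nth_ord_enum => ->.
apply: subset_leq_card; apply/fintype.subsetP => _ /imsetP[q fq ->]; rewrite inE in fq.
have nthA (i : 'I_k) : nth 0%N (sort leq [seq val x | x <- enum (A q)]) i = val (ru (q i)).
  by rewrite sortA // (nth_map i) -?enumT ?size_enum_ord // nth_ord_enum.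
rewrite inE; apply/andP; split.
  have := congr1 size (sortA q fq).
  by rewrite size_sort size_map -cardE size_map -?enumT size_enum_ord => ->.
apply/forallP => i; apply/forallP => j; rewrite !pat_valE.
have -> : nth 0%N (sort leq [seq val x | x <- enum (A q)]) i = val (ru (q i)) by exact: nthA.
have -> : nth 0%N (sort leq [seq val x | x <- enum (A q)]) j = val (ru (q j)) by exact: nthA.
have pvs x : pat_val (mkp s) (val (ru x)) = val (rv x) by rewrite pat_valE /= sE.
rewrite !pvs; apply/eqP.
move/forallP: fq => fq.
case: (ltngtP (tagged p i) (tagged p j)) => [lt|lt|/val_inj/perm_inj->].
- by symmetry; apply: rv_lt; have /forallP/(_ j)/andP[_ /implyP/(_ lt)] := fq i.
- symmetry; apply/negbTE; rewrite -leqNgt; apply/ltnW/rv_lt.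
  by have /forallP/(_ i)/andP[_ /implyP/(_ lt)] := fq j.
- by rewrite ltnn.
Qed.

(** A permutation is determined by its comparisons: [s i] counts the [j] with [s j < s i]. *)
Lemma occ_disjoint k (s t : 'S_k) (P : perm_t) A :
  A \in occ (mkp s) P -> A \in occ (mkp t) P -> s = t.
Proof.
rewrite !inE => /andP[_ /forallP hs] /andP[_ /forallP ht].
have st i j : (s i < s j)%N = (t i < t j)%N.
  have /forallP/(_ j)/eqP := hs i; have /forallP/(_ j)/eqP := ht i.
  rewrite -[X in pat_val (mkp s) X]/(val (i : 'I_(tag (mkp s)))).
  by rewrite !(@pat_valE (mkp _)) /= => -> ->.
have card_lt (r : 'S_k) i : #|[set j | (r j < r i)%N]| = r i.
  have -> : [set j | (r j < r i)%N] = r @^-1: [set j : 'I_k | (j < r i)%N].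
    by apply/finset.setP => j; rewrite !inE.
  rewrite card_preimset; last exact: perm_inj.
  by rewrite -sum1dep_card -(big_ord_widen k (fun=> 1%N)) ?sum1_card ?card_ord // ltnW.
apply/permP => i; apply: val_inj => /=; rewrite -card_lt -[RHS]card_lt.
by congr #|pred_of_set _|; apply/finset.setP => j; rewrite !inE st.
Qed.

Lemma sum_occ_le k (P : perm_t) : (\sum_(s : 'S_k) #|occ (mkp s) P| <= 'C(tag P, k))%N.
Proof.
have -> : 'C(tag P, k) = #|[set A : {set 'I_(tag P)} | #|A| == k]|.
  by rewrite card_draws card_ord.
have cardS (T : finType) (B : {set T}) : #|B| = (\sum_(x : T) (x \in B))%N.
  by rewrite -sum1_card big_mkcond /=; apply: eq_bigr => x _; case: (x \in B).
under eq_bigr do rewrite cardS; rewrite exchange_big [leqRHS]cardS /=.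
apply: leq_sum => A _; rewrite inE.
have [/existsP[s As]|/existsPn nA] := boolP [exists s : 'S_k, A \in occ (mkp s) P]; last first.
  by rewrite big1 // => s _; rewrite (negPf (nA s)).
rewrite (bigD1 s) //= As big1 => [|t ts].
  by move: As; rewrite inE => /andP[->].
by case: (boolP (A \in _)) => // At; rewrite (occ_disjoint At As) eqxx in ts.
Qed.

(** * Order statistics *)

Lemma card_ord_lt k n : (n <= k)%N -> #|[set j : 'I_k | (j < n)%N]| = n.
Proof. by move=> nk; rewrite -sum1dep_card -(big_ord_widen k (fun=> 1%N)) ?sum1_card ?card_ord. Qed.

Section Sorting.
Variable k : nat.
Implicit Types (f : 'I_k -> nat) (s : 'S_k).

Definition sorts f s := [forall i : 'I_k, forall j : 'I_k, (i <= j)%N ==> (f (s i) <= f (s j))%N].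

Lemma ex_sorting f : exists s, sorts f s.
Proof.
pose r := sort (relpre f leq) (enum 'I_k).
have /tuple_permP[s es] : perm_eq r (ord_tuple k) by rewrite perm_sort.
have tot : total (relpre f leq) by move=> i j; apply: leq_total.
have tr : transitive (relpre f leq) by move=> i j l /=; apply: leq_trans.
have nthr (i i0 : 'I_k) : nth i0 r i = s i by rewrite es -tnth_nth tnth_mktuple tnth_ord_tuple.
exists s; apply/forallP => i; apply/forallP => j; apply/implyP => ij.
rewrite -(nthr i i) -(nthr j i).
apply: (sorted_leq_nth tr _ i (sort_sorted tot _)) => //; first by move=> l /=.
  by rewrite inE size_sort size_enum_ord.
by rewrite inE size_sort size_enum_ord.
Qed.

Definition sorting f : 'S_k := xchoose (ex_sorting f).

Lemma sortingP f (i j : 'I_k) : (i <= j)%N -> (f (sorting f i) <= f (sorting f j))%N.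
Proof. by have /forallP/(_ i)/forallP/(_ j)/implyP := xchooseP (ex_sorting f). Qed.

(** The right side does not mention [s]: hence all sortings of [f] give the same sorted values, and
    the law of an order statistic is a binomial tail. *)
Lemma sorts_lt f s (i : 'I_k) X : (forall i j : 'I_k, (i <= j)%N -> (f (s i) <= f (s j))%N) ->
  (f (s i) < X)%N = (i < #|[set j | (f j < X)%N]|)%N.
Proof.
move=> mono.
have -> : #|[set j | (f j < X)%N]| = #|[set j | (f (s j) < X)%N]|.
  rewrite -[LHS](card_preimset _ (@perm_inj _ s)); apply: eq_card => j.
  by rewrite !inE.
apply/idP/idP => h.
  rewrite -[leqLHS](card_ord_lt (ltn_ord i)); apply: subset_leq_card; apply/fintype.subsetP => j.
  by rewrite !inE ltnS => /mono ji; apply: leq_ltn_trans h.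
rewrite ltnNge; apply/negP => h'.
suff : (#|[set j | (f (s j) < X)%N]| <= i)%N by rewrite leqNgt h.
rewrite -[leqRHS](card_ord_lt (ltnW (ltn_ord i))); apply: subset_leq_card.
apply/fintype.subsetP => j; rewrite !inE => jX; rewrite ltnNge; apply/negP => /mono ij.
by have := leq_ltn_trans (leq_trans h' ij) jX; rewrite ltnn.
Qed.

Lemma sorts_uniq f s (i : 'I_k) : (forall i j : 'I_k, (i <= j)%N -> (f (s i) <= f (s j))%N) ->
  f (s i) = f (sorting f i).
Proof.
move=> mono; have e X : (f (s i) < X)%N = (f (sorting f i) < X)%N.
  by rewrite !sorts_lt //; apply: sortingP.
by apply/eqP; rewrite eqn_leq -ltnS e ltnSn -ltnS -e ltnSn.
Qed.

End Sorting.

Section OrderStatistics.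
Variables k m : nat.
Implicit Types f : {ffun 'I_k -> 'I_m}.

(* os f i is the i-th smallest value of f, counted from 0 *)
Definition os f : {ffun 'I_k -> 'I_m} := [ffun i => f (sorting (val \o f) i)].

Lemma os_lt f (i : 'I_k) X : (os f i < X)%N = (i < #|[set j | (f j < X)%N]|)%N.
Proof. by rewrite ffunE -(sorts_lt (f := val \o f) _ _ (@sortingP _ _)). Qed.

(** Classify [f] by the set [B] of arguments sent below [X]: more than [i] of them are required, and
    [X ^ #|B| * (m - X) ^ (k - #|B|)] maps share a given [B]. *)
Lemma card_os_lt (i : 'I_k) X : (X <= m)%N ->
  #|[set f | (os f i < X)%N]| = (\sum_(c < k.+1 | i < c) 'C(k, c) * (X ^ c * (m - X) ^ (k - c)))%N.
Proof.
move=> Xm.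
have cX : #|[pred y : 'I_m | (y < X)%N]| = X by rewrite -cardsE card_ord_lt.
have cX' : #|[pred y : 'I_m | ~~ (y < X)%N]| = (m - X)%N.
  by rewrite -[m in RHS]card_ord -(cardC [pred y : 'I_m | (y < X)%N]) cX addKn.
have fam (B : {set 'I_k}) :
    #|[set f : {ffun 'I_k -> 'I_m} | [set j | (f j < X)%N] == B]| = (X ^ #|B| * (m - X) ^ (k - #|B|))%N.
  have -> : #|[set f : {ffun 'I_k -> 'I_m} | [set j | (f j < X)%N] == B]| =
      #|family (fun j => if j \in B then [pred y : 'I_m | (y < X)%N] else [pred y : 'I_m | ~~ (y < X)%N])|.
    apply: eq_card => f; rewrite inE; apply/eqP/familyP => [<- j|h].
      by rewrite inE; case: ifP => h; rewrite inE h.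
    apply/finset.setP => j; rewrite inE; have := h j.
    by case: (j \in B); rewrite inE //; apply/negbTE.
  rewrite card_family foldrE big_image /=.
  rewrite (bigID (fun j => j \in B)) /=; congr (_ * _)%N.
    rewrite (eq_bigr (fun=> X)) => [|j ->]; last exact: cX.
    by rewrite prod_nat_const.
  rewrite (eq_bigr (fun=> (m - X)%N)) => [|j /negPf->]; last exact: cX'.
  rewrite prod_nat_const; congr (_ ^ _)%N; have := cardC (mem B);
  by rewrite card_ord => /(congr1 (subn^~ #|B|)); rewrite addKn.
rewrite -sum1dep_card.
rewrite (partition_big (fun f : {ffun 'I_k -> 'I_m} => [set j | (f j < X)%N])
  (fun B => (i < #|B|)%N)) /=; last first.
  by move=> f; rewrite os_lt.
have -> : (\sum_(B : {set 'I_k} | i < #|B|)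
    \sum_(f : {ffun 'I_k -> 'I_m} | (os f i < X)%N && ([set j | (f j < X)%N] == B)) 1
   = \sum_(B : {set 'I_k} | i < #|B|) X ^ #|B| * (m - X) ^ (k - #|B|))%N.
  apply: eq_bigr => B iB; rewrite -fam -sum1dep_card; apply: eq_bigl => f.
  by rewrite os_lt; case: eqP => [->|_]; rewrite ?iB ?andbF.
have cB (B : {set 'I_k}) : (#|B| < k.+1)%N by rewrite ltnS -[leqRHS]card_ord max_card.
rewrite (partition_big (fun B => Ordinal (cB B)) (fun c => (i < c)%N)) //=.
apply: eq_bigr => c ic; rewrite -[k in 'C(k, _)]card_ord -card_draws -sum_nat_const.
rewrite [RHS](eq_bigl (fun B : {set 'I_k} => #|B| == c)) => [|B]; last by rewrite inE.
apply: congr_big => // [B|B /andP[_ /eqP<-]] //.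
by rewrite -val_eqE /=; case: eqP => [->|]; rewrite ?ic ?andbF.
Qed.

End OrderStatistics.

(* The density of s in the step measure with cell weights A is pnum A s / (k! m^(2k)), because the
   pattern of k independent uniform points is independent of the order statistics of their coordinates. *)
Definition pnum (F : comPzRingType) m (A : 'I_m -> 'I_m -> F) k (s : 'S_k) : F :=
  \sum_(f : {ffun 'I_k -> 'I_m}) \sum_(g : {ffun 'I_k -> 'I_m}) \prod_i A (os f i) (os g (s i)).

(** For fixed [f] and [g], sorting both only multiplies [s] on either side by a fixed permutation,
    so the sum over [s] may use the unsorted values. Then the sums over [f] and [g] factor. *)
Lemma sum_pnum (F : comPzRingType) m (A : 'I_m -> 'I_m -> F) k :
  \sum_(s : 'S_k) pnum A s = (\sum_x \sum_y A x y) ^+ k *+ k`!.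
Proof.
have swap (f g : {ffun 'I_k -> 'I_m}) :
    \sum_(s : 'S_k) \prod_i A (os f i) (os g (s i)) = \sum_(s : 'S_k) \prod_i A (f i) (g (s i)).
  pose sf := sorting (val \o f); pose sg := sorting (val \o g).
  pose h (s : 'S_k) := (sf * s * sg^-1)%g.
  have h_inj : injective h by move=> s t /mulIg/mulgI.
  rewrite (reindex_inj h_inj) /=; apply: eq_bigr => s _.
  rewrite [RHS](reindex_inj (@perm_inj _ sf)) /=; apply: eq_bigr => i _.
  by rewrite !ffunE -/sf -/sg !permM permKV.
rewrite /pnum exchange_big /=; under eq_bigr do rewrite exchange_big /=.
under eq_bigr do under eq_bigr do rewrite swap.
under eq_bigr do rewrite exchange_big /=; rewrite exchange_big /=.
have each (s : 'S_k) : \sum_(f : {ffun 'I_k -> 'I_m}) \sum_(g : {ffun 'I_k -> 'I_m})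
    \prod_i A (f i) (g (s i)) = (\sum_x \sum_y A x y) ^+ k.
  rewrite -[RHS]/(_ ^+ k) -[k in RHS]card_ord -prodr_const bigA_distr_bigA /=.
  apply: eq_bigr => f _; rewrite bigA_distr_bigA /=.
  pose h (t : 'S_k) (g : {ffun 'I_k -> 'I_m}) := [ffun i => g (t i)].
  rewrite (reindex (h s^-1%g)); last first.
    by exists (h s) => g _; apply/ffunP => i; rewrite !ffunE ?permK ?permKV.
  by apply: eq_bigr => g _; apply: eq_bigr => i _; rewrite ffunE permK.
under eq_bigr do rewrite each; rewrite sumr_const; congr (_ *+ _).
by rewrite -card_Sn; apply: eq_card.
Qed.

(** * Linearization at the uniform measure *)

Section Quantile.
Variable F : numFieldType.

(* the distribution function of the i-th order statistic of k uniform points of [0, 1] *)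
Definition quantile k i : {poly F} := \sum_(c < k.+1 | (i < c)%N) bern k c 'X.

Lemma horner_bern k c (x : F) : (bern k c ('X : {poly F})).[x] = bern k c x.
Proof.
by rewrite /bern hornerMn hornerM !horner_exp hornerD hornerN hornerX hornerC.
Qed.

Lemma deriv_bern k c :
  (bern k.+1 c.+1 ('X : {poly F}))^`() = (bern k c 'X - bern k c.+1 'X) *+ k.+1.
Proof.
have dU n : ((1 - 'X) ^+ n : {poly F})^`() = - ((1 - 'X) ^+ n.-1) *+ n.
  by rewrite deriv_exp derivB -polyC1 derivC derivX sub0r polyC1 mulN1r.
rewrite /bern derivMn derivM derivXn dU subSS -subnS mulrnBl -!mulrnA.
have -> : ('C(k, c) * k.+1 = c.+1 * 'C(k.+1, c.+1))%N by rewrite mulnC mul_bin_diag.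
have -> : ('C(k, c.+1) * k.+1 = (k - c) * 'C(k.+1, c.+1))%N.
  by rewrite mulnC; have := mul_bin_down k.+1 c.+1; rewrite /= subSS.
by rewrite !mulrnA -mulrnBl mulrnAl mulrnAr mulrN mulNrn.
Qed.

(** The tail sum telescopes under [deriv_bern]. The induction descends from [i = k.+1], where the
    tail is empty and [bern k k.+1] is 0. *)
Lemma deriv_quantile k i : (i <= k.+1)%N -> (quantile k.+1 i)^`() = bern k i 'X *+ k.+1.
Proof.
move=> ik; have -> : i = (k.+1 - (k.+1 - i))%N by rewrite subKn.
elim: (k.+1 - i)%N (leq_subr i k.+1) => [|j IH] jk.
  rewrite subn0 /quantile big1 => [|c]; first by rewrite deriv0 /bern bin_small // mulr0n mul0rn.
  by rewrite ltnNge -ltnS ltn_ord.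
have le : (k.+1 - j.+1 < k.+2)%N by rewrite ltnS leq_subr.
have {IH} := IH (ltnW jk).
have -> : (k.+1 - j = (k.+1 - j.+1).+1)%N by rewrite subnSK.
set c := (k.+1 - j.+1)%N => IH.
have ck : (c.+1 < k.+2)%N by rewrite /c; lia.
rewrite /quantile (bigD1 (Ordinal ck)) //= derivD deriv_bern.
rewrite (eq_bigl (fun l : 'I_k.+2 => (c.+1 < l)%N)) => [|l]; last first.
  by rewrite -val_eqE /= [RHS]ltn_neqAle eq_sym andbC.
by rewrite IH mulrnBl subrK.
Qed.

Lemma size_bern k c : (c <= k)%N -> (size (bern k c ('X : {poly F})) <= k.+1)%N.
Proof.
move=> ck; rewrite /bern -mulr_natr -[X in _ * X]polyC_natr mulrC mul_polyC.
apply: leq_trans (size_scale_leq _ _) _; apply: leq_trans (size_polyMleq _ _) _.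
rewrite size_polyXn addSn /=; apply: leq_trans (_ : (c + (k - c).+1 <= _)%N); last by rewrite addnS subnKC.
rewrite leq_add2l; apply: leq_trans (size_poly_exp_leq _ _) _.
have : (size (1 - 'X : {poly F})%R <= 2)%N.
  by rewrite -opprB size_polyN -polyC1 size_XsubC.
by case: (size _) => [|[|[|]]] // _ /=; rewrite ?mul0n ?mul1n.
Qed.

Lemma size_quantile k i : (size (quantile k i) <= k.+1)%N.
Proof.
by apply: (leq_trans (size_sum _ _ _)); apply/bigmax_leqP => c _; apply: size_bern; rewrite -ltnS.
Qed.

Lemma card_os_quantile k m (i : 'I_k) X : (0 < m)%N -> (X <= m)%N ->
  #|[set f : {ffun 'I_k -> 'I_m} | (os f i < X)%N]|%:R / m%:R ^+ k = (quantile k i).[X%:R / m%:R].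
Proof.
move=> m0 Xm; have mN0 : m%:R != 0 :> F by rewrite pnatr_eq0 -lt0n.
rewrite card_os_lt // natr_sum mulr_suml horner_sum; apply: eq_bigr => c _.
rewrite horner_bern /bern; have ck : (c <= k)%N by rewrite -ltnS.
have -> : 1 - X%:R / m%:R = (m - X)%:R / m%:R :> F by rewrite natrB // mulrBl divff.
have -> : m%:R ^+ k = m%:R ^+ c * m%:R ^+ (k - c) :> F by rewrite -exprD subnKC.
rewrite !expr_div_n !natrM !natrX invfM; ring.
Qed.

End Quantile.

Lemma deriv_sum (R : nzRingType) (I : Type) (r : seq I) (P : pred I) (f : I -> {poly R}) :
  (\sum_(i <- r | P i) f i)^`() = \sum_(i <- r | P i) (f i)^`().
Proof. exact: raddf_sum. Qed.

Section Grid.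
Variables (F : numFieldType) (m : nat).
Hypothesis m_gt0 : (0 < m)%N.

Let mN0 : m%:R != 0 :> F. Proof. by rewrite pnatr_eq0 -lt0n. Qed.

Definition osprob k (i : 'I_k) (x : 'I_m) : F :=
  #|[set f : {ffun 'I_k -> 'I_m} | os f i == x]|%:R / m%:R ^+ k.

(** The derivative of [pden] at the all-one weights with respect to the weight of the cell [(x, y)]:
    the discrete counterpart of [grad]. *)
Definition gridgrad (p : perm_t) (x y : 'I_m) : F :=
  \sum_(i < tag p) osprob i x * osprob (tagged p i) y.

Lemma sum_osprob k (i : 'I_k) X : (X <= m)%N ->
  \sum_(x : 'I_m | (x < X)%N) osprob i x = (quantile F k i).[X%:R / m%:R].
Proof.
move=> Xm; rewrite -card_os_quantile // -mulr_suml -natr_sum; congr (_%:R / _).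
rewrite -[RHS]sum1dep_card (partition_big (fun f : {ffun 'I_k -> 'I_m} => os f i) (fun x => (x < X)%N)) //=.
apply: eq_bigr => x xX; rewrite -sum1dep_card; apply: eq_bigl => f.
by case: eqP => [->|]; rewrite ?xX ?andbF.
Qed.

Lemma grid_poly_eq0 (P : {poly F}) : (size P <= m.+1)%N ->
  (forall X, (X <= m)%N -> P.[X%:R / m%:R] = 0) -> P = 0.
Proof.
move=> sP h; apply: (@roots_geq_poly_eq0 _ P [seq n%:R / m%:R | n <- iota 0 m.+1]).
- by apply/allP => x /mapP[n]; rewrite mem_iota add0n ltnS => nm ->; rewrite rootE h.
- rewrite map_inj_uniq ?iota_uniq // => i j /(mulIf (invr_neq0 mN0))/eqP.
  by rewrite eqr_nat => /eqP.
- by rewrite size_map size_iota.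
Qed.

(* Summing the relation over the cells below (X, Y) gives polynomials in X / m and Y / m that
   agree on more points than their degrees; then differentiate in each variable. *)
Lemma gridgrad_free (l : seq perm_t) (a : perm_t -> F) c :
  indep F l -> {in l, forall p, 0 < tag p <= m}%N ->
  (forall x y, \sum_(p <- l) a p * gridgrad p x y = c) -> {in l, forall p, a p = 0}.
Proof.
move=> il hl h.
pose Q (p : perm_t) (i : 'I_(tag p)) := quantile F (tag p) i.
pose b (p : perm_t) (i : 'I_(tag p)) : {poly F} := bern (tag p).-1 i 'X *+ tag p.
have dQ (p : perm_t) (i : 'I_(tag p)) : (Q p i)^`() = b p i.
  rewrite /Q /b; case: p i => -[|k] s i /=; first by case: i.
  by rewrite deriv_quantile // ltnW.
have sQ (p : perm_t) (i : 'I_(tag p)) : p \in l -> (size (Q p i) <= m.+1)%N.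
  by move=> /hl/andP[_ pm]; apply: leq_trans (size_quantile F _ _) _.
have size_le (w : perm_t -> F) (v : forall p : perm_t, 'I_(tag p) -> F)
    (t : forall p : perm_t, 'I_(tag p) -> 'I_(tag p)) e :
    (size (\sum_(p <- l) w p *: (\sum_i v p i *: Q p (t p i)) - e *: 'X)%R <= m.+1)%N.
  apply: leq_trans (size_polyD _ _) _; rewrite size_polyN geq_max; apply/andP; split; last first.
    by apply: leq_trans (size_scale_leq _ _) _; rewrite size_polyX.
  apply: leq_trans (size_sum _ _ _) _; apply/bigmax_leqP_seq => p pl _.
  apply: leq_trans (size_scale_leq _ _) _; apply: leq_trans (size_sum _ _ _) _.
  by apply/bigmax_leqP => i _; apply: leq_trans (size_scale_leq _ _) (sQ _ _ pl).
have h1 X Y : (X <= m)%N -> (Y <= m)%N ->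
    \sum_(p <- l) a p * (\sum_i (Q p i).[X%:R / m%:R] * (Q p (tagged p i)).[Y%:R / m%:R])
    = c * m%:R ^+ 2 * (X%:R / m%:R) * (Y%:R / m%:R).
  move=> Xm Ym.
  have <- : \sum_(x : 'I_m | (x < X)%N) \sum_(y : 'I_m | (y < Y)%N)
    \sum_(p <- l) a p * gridgrad p x y = c * m%:R ^+ 2 * (X%:R / m%:R) * (Y%:R / m%:R).
    have sc n e : (n <= m)%N -> \sum_(x : 'I_m | (x < n)%N) e = e *+ n :> F.
      by move=> nm; rewrite -(big_ord_widen m (fun=> e) nm) sumr_const card_ord.
    under eq_bigr do under eq_bigr do rewrite h.
    by rewrite !sc // -(mulr_natr (c *+ Y)) -(mulr_natr c); field.
  under [RHS]eq_bigr do rewrite exchange_big /=; rewrite exchange_big /=.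
  apply: eq_bigr => p _; rewrite mulr_sumr.
  under [RHS]eq_bigr do rewrite -mulr_sumr; rewrite -mulr_sumr -mulr_sumr; congr (_ * _).
  rewrite /gridgrad; under [RHS]eq_bigr do rewrite exchange_big /=.
  rewrite exchange_big /=; apply: eq_bigr => i _.
  by rewrite -!sum_osprob // mulr_suml; apply: eq_bigr => x _; rewrite mulr_sumr.
have h2 X y : (X <= m)%N ->
    \sum_(p <- l) a p * (\sum_i (Q p i).[X%:R / m%:R] * (b p (tagged p i)).[y])
    = c * m%:R ^+ 2 * (X%:R / m%:R).
  move=> Xm.
  pose P := \sum_(p <- l) a p *: (\sum_i (Q p i).[X%:R / m%:R] *: Q p (tagged p i))
    - (c * m%:R ^+ 2 * (X%:R / m%:R)) *: 'X.
  have P0 : P = 0.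
    apply: grid_poly_eq0 => [|Y Ym].
      exact: (size_le a (fun p i => (Q p i).[X%:R / m%:R]) (fun p => tagged p)).
    rewrite hornerD hornerN horner_sum hornerZ hornerX -(h1 X Y) //.
    apply/eqP; rewrite subr_eq0; apply/eqP; apply: eq_bigr => p _.
    by rewrite hornerZ horner_sum; congr (_ * _); apply: eq_bigr => i _; rewrite hornerZ.
  move/(congr1 (fun p : {poly F} => p^`().[y])): P0.
  rewrite derivB deriv_sum derivZ derivX deriv0 horner0 hornerD hornerN hornerZ hornerC mulr1.
  move/eqP; rewrite subr_eq0 => /eqP <-; rewrite horner_sum; apply: eq_bigr => p _.
  rewrite derivZ deriv_sum hornerZ horner_sum; congr (_ * _); apply: eq_bigr => i _.
  by rewrite derivZ hornerZ dQ.
have h3 x y : \sum_(p <- l) a p * (\sum_i (b p i).[x] * (b p (tagged p i)).[y]) = c * m%:R ^+ 2.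
  pose P := \sum_(p <- l) a p *: (\sum_i (b p (tagged p i)).[y] *: Q p i) - (c * m%:R ^+ 2) *: 'X.
  have P0 : P = 0.
    apply: grid_poly_eq0 => [|X Xm].
      exact: (size_le a (fun p i => (b p (tagged p i)).[y]) (fun p i => i)).
    rewrite hornerD hornerN horner_sum hornerZ hornerX -(h2 X y) //.
    apply/eqP; rewrite subr_eq0; apply/eqP; apply: eq_bigr => p _.
    by rewrite hornerZ horner_sum; congr (_ * _); apply: eq_bigr => i _; rewrite hornerZ mulrC.
  move/(congr1 (fun p : {poly F} => p^`().[x])): P0.
  rewrite derivB deriv_sum derivZ derivX deriv0 horner0 hornerD hornerN hornerZ hornerC mulr1.
  move/eqP; rewrite subr_eq0 => /eqP <-; rewrite horner_sum; apply: eq_bigr => p _.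
  rewrite derivZ deriv_sum hornerZ horner_sum; congr (_ * _); apply: eq_bigr => i _.
  by rewrite derivZ hornerZ dQ mulrC.
move=> p pl; have /andP[p0 _] := hl p pl.
(* Each of the two differentiations contributed a factor [tag p], so independence is applied to
   rescaled coefficients. *)
have/eqP : a p *+ (tag p * tag p) = 0.
  apply: (il (fun p => a p *+ (tag p * tag p)) (c * m%:R ^+ 2)) pl => x y.
  rewrite -(h3 x y); apply: eq_bigr => q _; rewrite mulrnAl -mulrnAr; congr (_ * _).
  rewrite /grad -sumrMnl; apply: eq_bigr => i _; rewrite /b hornerMn horner_bern hornerMn horner_bern.
  by rewrite mulrnAl mulrnAr -mulrnA.
by rewrite mulrn_eq0 muln_eq0 orbb -leqn0 leqNgt p0 => /eqP.
Qed.


End Grid.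

(** This is [k!] times the density of [p] in the step measure, so that the quasirandom value is 1
    for every order. *)
Definition pden (F : fieldType) m (A : 'I_m -> 'I_m -> F) (p : perm_t) : F :=
  pnum A (tagged p) / (m%:R ^+ tag p) ^+ 2.

(** * Newton's method around the uniform weights *)

Section Newton.
Variable F : archiRealFieldType.

(** The part of the product beyond first order has a Lipschitz constant proportional to [r] on the
    ball of radius [r]; this is what makes the Newton step a contraction near 0. *)
Lemma prod1D_lipschitz n : exists2 C : F, 0 <= C &
  forall (r e : F) (w v : 'I_n -> F), 0 <= r <= 1 -> 0 <= e ->
    (forall i, `|w i| <= r) -> (forall i, `|v i| <= r) -> (forall i, `|w i - v i| <= e) ->
  `|(\prod_i (1 + w i) - 1 - \sum_i w i) - (\prod_i (1 + v i) - 1 - \sum_i v i)| <= C * r * e.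
Proof.
(* The induction on the number of factors also needs the Lipschitz bound of the product itself and
   its distance from 1. *)
suff [C C0 hC] : exists2 C : F, 0 <= C &
  forall (r e : F) (w v : 'I_n -> F), 0 <= r <= 1 -> 0 <= e ->
    (forall i, `|w i| <= r) -> (forall i, `|v i| <= r) -> (forall i, `|w i - v i| <= e) ->
  [/\ `|(\prod_i (1 + w i) - 1 - \sum_i w i) - (\prod_i (1 + v i) - 1 - \sum_i v i)| <= C * r * e,
    `|\prod_i (1 + w i) - \prod_i (1 + v i)| <= C * e & `|\prod_i (1 + v i) - 1| <= C * r].
  by exists C => // r e w v hr he hw hv hwv; have [] := hC r e w v hr he hw hv hwv.
elim: n => [|n [C C0 IH]].
  exists 0 => // r e w v _ _ _ _ _; rewrite !big_ord0 !subr0 !subrr !mul0r normr0.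
  by split.
exists (3 * C + 1) => [|r e w v hr he hw hv hwv]; first by rewrite addr_ge0 // mulr_ge0.
have [] := IH r e (fun i => w (widen_ord (leqnSn n) i)) (fun i => v (widen_ord (leqnSn n) i))
  hr he (fun i => hw _) (fun i => hv _) (fun i => hwv _).
rewrite !big_ord_recr /=.
set P := \prod_i _; set Q := \prod_i _; set S := \sum_i _; set T := \sum_i _.
have := hw ord_max; have := hv ord_max; have := hwv ord_max.
set x := w ord_max; set y := v ord_max => hxy hy hx h1 h2 h3.
have /andP[r0 r1] := hr.
have Q1 : `|Q| <= 1 + C.
  rewrite -[Q](subrK 1) addrC; apply: le_trans (ler_normD _ _) _; rewrite normr1 lerD2l.
  by apply: le_trans h3 _; rewrite ler_piMr.
split.
- have -> : P * (1 + x) - 1 - (S + x) - (Q * (1 + y) - 1 - (T + y))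
    = (P - 1 - S - (Q - 1 - T)) + (x * (P - Q) + (x - y) * (Q - 1)) by ring.
  apply: le_trans (ler_normD _ _) _.
  apply: (@le_trans _ _ (C * r * e + (r * (C * e) + e * (C * r)))).
    apply: lerD => //; apply: le_trans (ler_normD _ _) _; rewrite !normrM.
    by apply: lerD; apply: ler_pM.
  have : 0 <= r * e by apply: mulr_ge0.
  by nra.
- have -> : P * (1 + x) - Q * (1 + y) = (P - Q) * (1 + x) + Q * (x - y) by ring.
  apply: le_trans (ler_normD _ _) _; rewrite !normrM.
  apply: (@le_trans _ _ (C * e * 2 + (1 + C) * e)); last by nra.
  apply: lerD; apply: ler_pM => //.
  by apply: le_trans (ler_normD _ _) _; rewrite normr1; lra.
- have -> : Q * (1 + y) - 1 = (Q - 1) * (1 + y) + y by ring.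
  apply: le_trans (ler_normD _ _) _; rewrite !normrM.
  apply: (@le_trans _ _ (C * r * 2 + r)); last by nra.
  apply: lerD => //; apply: ler_pM => //.
  by apply: le_trans (ler_normD _ _) _; rewrite normr1; lra.
Qed.

Variable m : nat.
Hypothesis m_gt0 : (0 < m)%N.
Implicit Types u : 'I_m -> 'I_m -> F.

Let mN0 : m%:R != 0 :> F. Proof. by rewrite pnatr_eq0 -lt0n. Qed.

Definition linear_part (p : perm_t) u : F := \sum_x \sum_y u x y * gridgrad F p x y.

Definition remainder (p : perm_t) u : F := pden (fun x y => 1 + u x y) p - 1 - linear_part p u.

Lemma linE p u : linear_part p u = (\sum_(f : {ffun 'I_(tag p) -> 'I_m}) \sum_(g : {ffun 'I_(tag p) -> 'I_m})
  \sum_i u (os f i) (os g (tagged p i))) / (m%:R ^+ tag p) ^+ 2.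
Proof.
have pk k (i : 'I_k) (x : 'I_m) : osprob F i x * m%:R ^+ k =
    \sum_(f : {ffun 'I_k -> 'I_m}) (os f i == x)%:R.
  rewrite /osprob mulfVK ?expf_neq0 // -sum1dep_card natr_sum big_mkcond /=.
  by apply: eq_bigr => f _; case: eqP.
apply: (mulIf (x := (m%:R ^+ tag p) ^+ 2)); first by rewrite !expf_neq0.
rewrite mulfVK ?expf_neq0 // /linear_part mulr_suml.
under eq_bigr do rewrite mulr_suml.
have -> : \sum_(f : {ffun 'I_(tag p) -> 'I_m}) \sum_(g : {ffun 'I_(tag p) -> 'I_m})
    \sum_i u (os f i) (os g (tagged p i)) =
  \sum_(f : {ffun 'I_(tag p) -> 'I_m}) \sum_(g : {ffun 'I_(tag p) -> 'I_m})
    \sum_i \sum_x \sum_y u x y * ((os f i == x)%:R * (os g (tagged p i) == y)%:R).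
  apply: eq_bigr => f _; apply: eq_bigr => g _; apply: eq_bigr => i _.
  rewrite (bigD1 (os f i)) //= (bigD1 (os g (tagged p i))) //= !eqxx !mulr1.
  rewrite big1 ?addr0 => [|y /negPf ny]; last by rewrite [_ == y]eq_sym ny !mulr0.
  rewrite big1 ?addr0 // => x /negPf nx; rewrite big1 // => y _.
  by rewrite [_ == x]eq_sym nx mul0r mulr0.
under [RHS]eq_bigr do under eq_bigr do rewrite exchange_big /=.
under [RHS]eq_bigr do rewrite exchange_big /=.
rewrite [RHS]exchange_big /=; apply: eq_bigr => x _.
under [RHS]eq_bigr do under eq_bigr do rewrite exchange_big /=.
under [RHS]eq_bigr do rewrite exchange_big /=.
rewrite [RHS]exchange_big /=; apply: eq_bigr => y _.
rewrite -mulrA /gridgrad mulr_suml.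
under [RHS]eq_bigr do under eq_bigr do rewrite -mulr_sumr.
under [RHS]eq_bigr do rewrite -mulr_sumr.
rewrite -mulr_sumr; congr (_ * _).
under [RHS]eq_bigr do rewrite exchange_big /=.
rewrite [RHS]exchange_big /=; apply: eq_bigr => i _.
rewrite expr2 mulrACA !pk mulr_suml; apply: eq_bigr => f _.
by rewrite mulr_sumr.
Qed.

(** [pden] and its linear part average over the same pairs [(f, g)], so the bound for products
    passes to the remainder. *)
Lemma remE p u : remainder p u = (\sum_(f : {ffun 'I_(tag p) -> 'I_m}) \sum_(g : {ffun 'I_(tag p) -> 'I_m})
  (\prod_i (1 + u (os f i) (os g (tagged p i))) - 1 - \sum_i u (os f i) (os g (tagged p i))))
    / (m%:R ^+ tag p) ^+ 2.
Proof.
rewrite /remainder linE /pden /pnum; set M := _ ^+ 2.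
have MN0 : M != 0 by rewrite !expf_neq0.
have one : 1 = (\sum_(f : {ffun 'I_(tag p) -> 'I_m}) \sum_(g : {ffun 'I_(tag p) -> 'I_m}) 1) / M :> F.
  rewrite !sumr_const card_ffun !card_ord -mulrnA natrM natrX -expr2 divff //.
rewrite [X in _ / M - X - _]one -!mulrBl -!sumrB; congr (_ / _); apply: eq_bigr => f _.
by rewrite -!sumrB.
Qed.

Lemma remainder0 p u : (forall x y, u x y = 0) -> remainder p u = 0.
Proof.
move=> u0; rewrite remE big1 ?mul0r // => f _; rewrite big1 // => g _.
by rewrite !big1 ?subrr ?subr0 // => i _; rewrite u0 ?addr0.
Qed.

Lemma rem_lipschitz p : exists2 C : F, 0 <= C &
  forall (r e : F) u v, 0 <= r <= 1 -> 0 <= e ->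
    (forall x y, `|u x y| <= r) -> (forall x y, `|v x y| <= r) ->
    (forall x y, `|u x y - v x y| <= e) -> `|remainder p u - remainder p v| <= C * r * e.
Proof.
have [C C0 hC] := prod1D_lipschitz (tag p); exists C => // r e u v hr he hu hv huv.
rewrite !remE -mulrBl; set M := _ ^+ 2.
have M0 : 0 < M by rewrite !exprn_gt0 // ltr0n.
rewrite normrM normfV (gtr0_norm M0) ler_pdivrMr // -sumrB.
apply: le_trans (ler_norm_sum _ _ _) _.
apply: (@le_trans _ _ (\sum_(f : {ffun 'I_(tag p) -> 'I_m}) \sum_(g : {ffun 'I_(tag p) -> 'I_m}) C * r * e)).
  apply: ler_sum => f _; rewrite -sumrB; apply: le_trans (ler_norm_sum _ _ _) _.
  by apply: ler_sum => g _; apply: hC => // i.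
by rewrite !sumr_const card_ffun !card_ord -mulrnA -mulr_natr natrM natrX -expr2.
Qed.

End Newton.

Section Solve.
Variables (F : archiRealFieldType) (m n : nat) (p : 'I_n -> perm_t).
Hypothesis m_gt0 : (0 < m)%N.
Hypothesis p_inj : injective p.
Hypothesis p_indep : indep F [seq p i | i <- enum 'I_n].
Hypothesis p_order : forall i, (0 < tag (p i) <= m)%N.

(** Independence modulo constants says that the rows [gridgrad (p j)] together with an all-one row
    are free. The columns of a right inverse are the directions, and the all-one row makes them
    preserve the total weight. *)
Lemma dual_directions : exists d : 'I_n -> 'I_m -> 'I_m -> F,
  (forall l, \sum_x \sum_y d l x y = 0) /\ (forall j l, linear_part (p j) (d l) = (j == l)%:R).
Proof.
pose T : finType := ('I_m * 'I_m)%type.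
pose M : 'M[F]_(n.+1, #|T|) := \matrix_(i, z)
  if unlift ord0 i is Some j then gridgrad F (p j) (enum_val z).1 (enum_val z).2 else 1.
have M_free : row_free M.
  apply: inj_row_free => v vM.
  have hv (x y : 'I_m) : \sum_j v ord0 (lift ord0 j) * gridgrad F (p j) x y = - v ord0 ord0.
    have /matrixP/(_ ord0 (enum_rank ((x, y) : T))) := vM.
    rewrite !mxE big_ord_recl mxE unlift_none mulr1 => /eqP; rewrite addrC addr_eq0 => /eqP <-.
    by apply: eq_bigr => j _; rewrite mxE liftK enum_rankK.
  (* Independence takes coefficients indexed by patterns; [p_inj] makes them well defined here. *)
  pose a q := \sum_j v ord0 (lift ord0 j) *+ (p j == q).
  have ap j : a (p j) = v ord0 (lift ord0 j).
    rewrite /a (bigD1 j) //= eqxx big1 ?addr0 // => i /negPf ij.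
    by rewrite (inj_eq p_inj) ij.
  have a0 j : v ord0 (lift ord0 j) = 0.
    rewrite -ap; apply: (gridgrad_free m_gt0 (c := - v ord0 ord0) p_indep).
    - by move=> q /mapP[i _ ->]; apply: p_order.
    - move=> x y; rewrite big_map big_enum /= -[RHS](hv x y).
      by apply: eq_bigr => i _; rewrite ap.
    - by apply: map_f; rewrite mem_enum.
  apply/rowP => j; rewrite mxE; case: (unliftP ord0 j) => [i ->|->]; first exact: a0.
  have := hv (Ordinal m_gt0) (Ordinal m_gt0); rewrite big1 => [/eqP|j' _].
    by rewrite eq_sym oppr_eq0 => /eqP.
  by rewrite a0 mul0r.
have MB := mulmxVp M_free; set B := pinvmx M in MB.
pose d l (x y : 'I_m) := B (enum_rank ((x, y) : T)) (lift ord0 l).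
have dE (g : 'I_m -> 'I_m -> F) l : \sum_x \sum_y d l x y * g x y =
    \sum_z g (enum_val z).1 (enum_val z).2 * B z (lift ord0 l).
  rewrite pair_bigA /= (reindex (fun z : 'I_#|T| => enum_val z : T)) /=; last first.
    by exists enum_rank => z _; rewrite ?enum_valK ?enum_rankK.
  by apply: eq_bigr => z _; rewrite mulrC /d -surjective_pairing enum_valK.
exists d; split=> [l|j l].
  have /matrixP/(_ ord0 (lift ord0 l)) := MB; rewrite !mxE => h.
  transitivity (\sum_x \sum_y d l x y * 1).
    by apply: eq_bigr => x _; apply: eq_bigr => y _; rewrite mulr1.
  rewrite (dE (fun _ _ => 1)) -[RHS]h; apply: eq_bigr => z _.
  by rewrite [M _ _]mxE unlift_none.
have /matrixP/(_ (lift ord0 j) (lift ord0 l)) := MB; rewrite !mxE => h.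
rewrite /linear_part dE -[RHS]/(_%:R) -(inj_eq (@lift_inj _ ord0)) -h.
by apply: eq_bigr => z _; rewrite [M _ _]mxE liftK.
Qed.

Lemma perturb (j0 : 'I_n) : exists2 t : F, 0 < t & forall e : F, 0 < e ->
  exists A : 'I_m -> 'I_m -> F, [/\ forall x y, 0 <= A x y, \sum_x \sum_y A x y = m%:R ^+ 2 &
    forall j, `|pden A (p j) - 1 - t *+ (j == j0)| <= e].
Proof.
have [d [d0 dlin]] := dual_directions.
pose U (t : 'I_n -> F) x y : F := \sum_l t l * d l x y.
pose B : F := 1 + \sum_l \sum_x \sum_y `|d l x y|.
have B0 : 0 < B by rewrite ltr_pwDl // sumr_ge0 // => l _; rewrite sumr_ge0 // => x _; rewrite sumr_ge0.
have U_le t r x y : (forall l, `|t l| <= r) -> 0 <= r -> `|U t x y| <= B * r.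
  move=> ht r0; apply: le_trans (ler_norm_sum _ _ _) _.
  apply: (@le_trans _ _ (\sum_l r * `|d l x y|)).
    by apply: ler_sum => l _; rewrite normrM ler_wpM2r.
  rewrite -mulr_sumr mulrC ler_wpM2r // /B; apply: (@le_trans _ _ (\sum_l \sum_x \sum_y `|d l x y|)).
    apply: ler_sum => l _; rewrite (bigD1 x) //= (bigD1 y) //= -addrA lerDl.
    by rewrite addr_ge0 // ?sumr_ge0 // => x' _; rewrite sumr_ge0.
  by rewrite lerDr.
have UB t s x y : U t x y - U s x y = U (fun l => t l - s l) x y.
  by rewrite /U -sumrB; apply: eq_bigr => l _; rewrite mulrBl.
have linU t j : linear_part (p j) (U t) = t j.
  transitivity (\sum_l t l * linear_part (p j) (d l)).
    rewrite /linear_part /U; under eq_bigr do under eq_bigr do rewrite mulr_suml.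
    under eq_bigr do rewrite exchange_big /=; rewrite exchange_big /=.
    apply: eq_bigr => l _; rewrite mulr_sumr; apply: eq_bigr => x _; rewrite mulr_sumr.
    by apply: eq_bigr => y _; rewrite mulrA.
  under eq_bigr do rewrite dlin; rewrite (bigD1 j) //= eqxx mulr1 big1 ?addr0 // => l.
  by rewrite eq_sym => /negPf->; rewrite mulr0.
have [C C0 hC] : exists2 C : F, 0 < C &
    forall (j : 'I_n) (r e : F) (u v : 'I_m -> 'I_m -> F), 0 <= r <= 1 -> 0 <= e ->
    (forall x y, `|u x y| <= r) -> (forall x y, `|v x y| <= r) ->
    (forall x y, `|u x y - v x y| <= e) -> `|remainder (p j) u - remainder (p j) v| <= C * r * e.
  have [c c0 hc] := fin_all_exists2 (fun j => rem_lipschitz F m_gt0 (p j)).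
  exists (1 + \sum_j c j) => [|j r e u v hr he hu hv huv].
    by rewrite ltr_pwDl // sumr_ge0.
  apply: le_trans (hc j r e u v hr he hu hv huv) _; have /andP[r0 _] := hr.
  rewrite !ler_wpM2r // (bigD1 j) //=; apply: ler_wpDl => //; rewrite lerDl sumr_ge0 //.
(* On this radius the remainder is a contraction and 1 + U stays nonnegative. *)
pose r0 : F := (2 * B * (1 + C * B))^-1.
have CB0 : 0 < C * B by rewrite mulr_gt0.
have r00 : 0 < r0 by rewrite invr_gt0 !mulr_gt0 // ltr_pwDl // ltW.
have r0E : B * r0 * (2 * (1 + C * B)) = 1 by rewrite /r0; field; rewrite !lt0r_neq0 // ltr_pwDl // ltW.
have Br0p : 0 < B * r0 by rewrite mulr_gt0.
have Br0 : B * r0 <= 2^-1 by nra.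
have CBr0 : C * (B * r0) * B <= 2^-1 by nra.
(* The target takes half of the radius, and the contraction bounds the remainder by the other half,
   so the iterates stay in the ball. *)
pose v j : F := r0 / 2 *+ (j == j0).
pose step (t : 'I_n -> F) j : F := v j - remainder (p j) (U t).
pose it s := iter s step (fun=> 0).
have rem0 j : remainder (p j) (U (fun=> 0)) = 0.
  by apply: remainder0 => // x y; rewrite /U big1 // => l _; rewrite mul0r.
have contract t s e j : (forall l, `|t l| <= r0) -> (forall l, `|s l| <= r0) -> 0 <= e ->
    (forall l, `|t l - s l| <= e) -> `|remainder (p j) (U t) - remainder (p j) (U s)| <= e / 2.
  move=> ht hs e0 hts; apply: (@le_trans _ _ (C * (B * r0) * (B * e))).
    apply: hC => [||x y|x y|x y].
    - by rewrite ltW //=; apply: le_trans Br0 _; lra.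
    - by rewrite mulr_ge0 // ltW.
    - by apply: U_le => //; apply: ltW.
    - by apply: U_le => //; apply: ltW.
    - by rewrite UB; apply: U_le.
  by rewrite mulrA [leRHS]mulrC ler_wpM2r.
have it_le s j : `|it s j| <= r0.
  elim: s j => [|s IH] j; first by rewrite /it /= normr0 ltW.
  rewrite /it iterS -/(it s) /step; apply: le_trans (ler_normB _ _) _.
  have := contract (it s) (fun=> 0) r0 j IH; rewrite rem0 subr0 => h.
  have {}h : `|remainder (p j) (U (it s))| <= r0 / 2.
    by apply: h => [l||l]; rewrite ?normr0 ?subr0 //; apply: ltW.
  have : `|v j| <= r0 / 2.
    rewrite /v; case: eqP => _ /=; last by rewrite mulr0n normr0 divr_ge0 // ltW.
    by rewrite mulr1n gtr0_norm // divr_gt0.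
  lra.
have itS s j : it s.+1 j = v j - remainder (p j) (U (it s)) by [].
have it_cauchy s j : `|it s.+1 j - it s j| <= r0 / 2 ^+ s.
  elim: s j => [|s IH] j.
    by have -> : it 0 j = 0 by []; rewrite subr0 expr0 divr1.
  have -> : it s.+2 j - it s.+1 j = - (remainder (p j) (U (it s.+1)) - remainder (p j) (U (it s))).
    by rewrite itS [it s.+1 j]itS; ring.
  rewrite normrN exprSr invfM mulrA; apply: contract => //.
  by rewrite divr_ge0 ?exprn_ge0 // ltW.
exists (r0 / 2) => [|e e0]; first by rewrite divr_gt0.
have [s hs] : exists s, r0 / 2 ^+ s <= e.
  exists (Num.bound (r0 / e)); rewrite ler_pdivrMr ?exprn_gt0 // mulrC -ler_pdivrMr //.
  have h : 0 <= r0 / e by rewrite divr_ge0 // ltW.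
  by apply: le_trans (ltW (archi_boundP h)) _; rewrite -natrX ler_nat ltnW // ltn_expl.
exists (fun x y => 1 + U (it s) x y); split=> [x y||j].
- have := le_trans (U_le _ _ x y (it_le s) (ltW r00)) Br0.
  by rewrite ler_norml => /andP[h _]; lra.
- under eq_bigr do rewrite big_split /= sumr_const card_ord.
  rewrite big_split /= sumr_const card_ord -mulrnA natrM -expr2 -[RHS]addr0; congr (_ + _).
  rewrite /U; under eq_bigr do rewrite exchange_big /=; rewrite exchange_big /= big1 // => l _.
  under eq_bigr do rewrite -mulr_sumr; rewrite -mulr_sumr d0 mulr0 //.
(* The residual of an iterate is exactly the next Newton increment. *)
- have := it_cauchy s j; rewrite itS.
  rewrite /remainder linU => h; rewrite -/(v j) distrC; apply: le_trans hs.
  suff <- : v j - (pden (fun x y => 1 + U (it s) x y) (p j) - 1 - it s j) - it s j =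
    v j - (pden (fun x y => 1 + U (it s) x y) (p j) - 1) by [].
  ring.
Qed.


End Solve.

(** * Sampling a step measure *)

Lemma densityE (R : realType) (p P : perm_t) : (tag p <= tag P)%N ->
  density R p P = #|occ p P|%:R / 'C(tag P, tag p)%:R.
Proof.
rewrite /density => ->; congr (_%:R / _); apply: eq_card => A.
by rewrite [RHS]inE; apply/idP/idP; rewrite in_setE.
Qed.

(** All densities of order [k] add up to at most 1, so one of them can exceed its target only by
    what the others may lose. *)
Lemma density_two_sided (R : realType) (P : perm_t) k (D : 'S_k -> R) e :
  (k <= tag P)%N -> \sum_s D s = 1 -> (forall s, D s - e <= density R (mkp s) P) ->
  forall s, `|density R (mkp s) P - D s| <= e *+ k`!.
Proof.
move=> kP D1 h s.
have C0 : 0 < 'C(tag P, k)%:R :> R by rewrite ltr0n bin_gt0.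
have sum1 : \sum_(t : 'S_k) density R (mkp t) P <= 1.
  have dE (t : 'S_k) : density R (mkp t) P = #|occ (mkp t) P|%:R / 'C(tag P, k)%:R.
    exact: (@densityE R (mkp t) P kP).
  rewrite (eq_bigr _ (fun t _ => dE t)).
  by rewrite -mulr_suml ler_pdivrMr // mul1r -natr_sum ler_nat sum_occ_le.
have e0 : 0 <= e.
  have : \sum_(t : 'S_k) (D t - e) <= \sum_(t : 'S_k) density R (mkp t) P by apply: ler_sum.
  rewrite sumrB D1 sumr_const => h1; have := le_trans h1 sum1.
  rewrite gerBl pmulrn_lge0 //; apply/card_gt0P; by exists 1%g.
have cS : #|{: 'S_k}| = (k`!.-1.+1)%N by rewrite prednK ?fact_gt0 // -card_Sn; apply: eq_card.
have -> : k`! = (k`!.-1.+1)%N by rewrite prednK ?fact_gt0.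
rewrite ler_norml; apply/andP; split.
  apply: le_trans (_ : - e <= _); last by have := h s; lra.
  by rewrite lerN2 mulrS lerDl mulrn_wge0.
have h1 : \sum_(t | t != s) (D t - e) <= \sum_(t | t != s) density R (mkp t) P by apply: ler_sum.
rewrite sumrB sumr_const in h1.
have cs : #|[pred t | t != s]| = k`!.-1 by rewrite cardC1 cS.
rewrite cs in h1; rewrite (bigD1 s) //= in sum1; rewrite (bigD1 s) //= in D1.
have := mulrS e k`!.-1; lra.
Qed.

Section Blowup.
Variables (m r b : nat) (n : 'I_m -> 'I_m -> nat).
Hypothesis r_gt0 : (0 < r)%N.
Hypothesis n_le : forall x y, (n x y <= b)%N.

Definition cell : finType := ('I_m * 'I_r)%type.

Definition cellkey (x : cell) : nat := (x.1 * r + x.2)%N.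

Lemma cellkey_inj : injective cellkey.
Proof.
move=> [x i] [y j]; rewrite /cellkey /= => e.
have ij : val i = val j.
  by have := congr1 (modn^~ r) e; rewrite /= !modnMDl !modn_small.
move: e; rewrite ij => /addIn/eqP; rewrite eqn_mul2r eqn0Ngt r_gt0 /= => /eqP xy.
by congr pair; apply: val_inj.
Qed.

Lemma cellkey_le (x y : cell) : (cellkey x <= cellkey y)%N -> (x.1 <= y.1)%N.
Proof.
rewrite /cellkey => h; rewrite leqNgt; apply/negP => lt.
have : (x.1 * r + x.2 < x.1 * r + 1)%N.
  apply: leq_ltn_trans h _; apply: (@leq_trans (y.1.+1 * r)).
    by rewrite mulSn addnC ltn_add2r.
  by apply: leq_trans (leq_addr _ _); rewrite leq_mul2r lt orbT.
by rewrite ltn_add2l ltnS leqn0 => /eqP x20; move: h lt; rewrite x20; case: (y) => -[y1 ?] [y2 ?] /=; nia.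
Qed.

(** Each of the [m] columns and rows is cut into [r] thin ones. Every thin square in the block
    [(x, y)] receives [n x y] points with equal coordinates, numbered by the last component. *)
Definition blowup_pt := {z : cell * cell * 'I_b | (z.2 < n z.1.1.1 z.1.2.1)%N}.

Lemma card_blowup_pt : #|{: blowup_pt}| = (r ^ 2 * \sum_x \sum_y n x y)%N.
Proof.
rewrite card_sig -sum1_card.
transitivity (\sum_(z : cell * cell) \sum_(t : 'I_b | t < n z.1.1 z.2.1) 1)%N.
  by rewrite pair_big_dep; apply: eq_bigl => z.
rewrite (eq_bigr (fun z : cell * cell => n z.1.1 z.2.1)) => [|z _]; last first.
  by rewrite sum1dep_card card_ord_lt.
rewrite -(pair_bigA _ (fun x y : cell => n x.1 y.1)) /=.
rewrite -(pair_bigA _ (fun (x : 'I_m) (i : 'I_r) => \sum_(y : cell) n x y.1)%N) /=.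
under eq_bigr do rewrite sum_nat_const card_ord; rewrite -big_distrr /= expnS expn1 -mulnA; congr (_ * _)%N.
rewrite big_distrr /=; apply: eq_bigr => x _.
rewrite -(pair_bigA _ (fun (y : 'I_m) (i : 'I_r) => n x y)) /=.
under eq_bigr do rewrite sum_nat_const card_ord; by rewrite big_distrr.
Qed.

Variable k : nat.
Implicit Types f g : {ffun 'I_k -> cell}.

Definition base f : {ffun 'I_k -> 'I_m} := [ffun i => (f i).1].

Definition csort f : 'S_k := sorting (cellkey \o f).

Lemma os_base f i : os (base f) i = (f (csort f i)).1.
Proof.
apply: val_inj; rewrite ffunE.
have := @sorts_uniq k (val \o base f) (csort f) i.
rewrite /= !ffunE => <- // i1 i2 /(sortingP (cellkey \o f)) /cellkey_le.
by rewrite !ffunE.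
Qed.

Lemma csort_lt f (i j : 'I_k) : injective f -> (i < j)%N ->
  (cellkey (f (csort f i)) < cellkey (f (csort f j)))%N.
Proof.
move=> f_inj ij; rewrite ltn_neqAle (sortingP (cellkey \o f) (ltnW ij)) andbT.
by apply/eqP => /cellkey_inj/f_inj/perm_inj e; rewrite e ltnn in ij.
Qed.

(** Choose distinct thin columns [f] and distinct thin rows [g], and take one of the [n] points
    where the [i]-th smallest column meets the [s i]-th smallest row. A given copy arises at most
    once for each pair of sorting permutations, whence [k! ^ 2]. *)
Lemma forms_ge (s : 'S_k) :
  (\sum_(f : {ffun 'I_k -> cell} | injectiveb f) \sum_(g : {ffun 'I_k -> cell} | injectiveb g)
    \prod_i n (os (base f) i) (os (base g) (s i))
  <= #|[set q | forms (fun z : blowup_pt => cellkey (val z).1.1) (fun z : blowup_pt => cellkey (val z).1.2)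
      (p := mkp s) q]| * k`! ^ 2)%N.
Proof.
set Q := [set q | _].
pose Z := [set z : {ffun 'I_k -> cell} * {ffun 'I_k -> cell} * {ffun 'I_k -> 'I_b} |
  [&& injectiveb z.1.1, injectiveb z.1.2 &
    [forall i, (z.2 i < n (os (base z.1.1) i) (os (base z.1.2) (s i)))%N]]].
have cZ : (\sum_(f : {ffun 'I_k -> cell} | injectiveb f) \sum_(g : {ffun 'I_k -> cell} | injectiveb g)
    \prod_i n (os (base f) i) (os (base g) (s i)) = #|Z|)%N.
  transitivity (\sum_(fg : {ffun 'I_k -> cell} * {ffun 'I_k -> cell} | injectiveb fg.1 && injectiveb fg.2)
      \prod_i n (os (base fg.1) i) (os (base fg.2) (s i)))%N; first by rewrite pair_big.
  rewrite -sum1dep_card.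
  transitivity (\sum_(fg : {ffun 'I_k -> cell} * {ffun 'I_k -> cell} | injectiveb fg.1 && injectiveb fg.2)
      \sum_(t : {ffun 'I_k -> 'I_b} | [forall i, (t i < n (os (base fg.1) i) (os (base fg.2) (s i)))%N]) 1)%N.
    apply: eq_bigr => fg _; rewrite sum1dep_card.
    have -> : #|[set t : {ffun 'I_k -> 'I_b} | [forall i, (t i < n (os (base fg.1) i) (os (base fg.2) (s i)))%N]]|
      = #|family (fun i => [pred t : 'I_b | (t < n (os (base fg.1) i) (os (base fg.2) (s i)))%N])|.
      by apply: eq_card => t; rewrite inE; apply/forallP/familyP => h i; have := h i; rewrite inE.
    rewrite card_family foldrE big_image /=; apply: eq_bigr => i _.
    by rewrite -[LHS](card_ord_lt (n_le _ _)) cardsE.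
  by rewrite pair_big_dep; apply: eq_bigl => z; rewrite andbA.
pose q0 (z : {ffun 'I_k -> cell} * {ffun 'I_k -> cell} * {ffun 'I_k -> 'I_b}) : {ffun 'I_k -> cell * cell * 'I_b} :=
  [ffun i => (z.1.1 (csort z.1.1 i), z.1.2 (csort z.1.2 (s i)), z.2 i)].
pose proj (q : {ffun 'I_k -> blowup_pt}) : {ffun 'I_k -> cell * cell * 'I_b} := [ffun i => val (q i)].
rewrite cZ -(card_in_imset (f := fun z => (q0 z, csort z.1.1, csort z.1.2))); last first.
  move=> [[f g] t] [[f' g'] t'] _ _ /= [/ffunP eq ef eg].
  have e i := eq i; congr (_, _, _); apply/ffunP => i.
  - by have := eq ((csort f)^-1%g i); rewrite !ffunE /= -ef permKV => -[].
  - by have := eq (s^-1%g ((csort g)^-1%g i)); rewrite !ffunE /= -eg !permKV => -[].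
  - by have := eq i; rewrite !ffunE => -[].
apply: (@leq_trans #|finset.setX (finset.setX (proj @: Q) [set: 'S_k]) [set: 'S_k]|); last first.
  rewrite !cardsX !cardsT !card_Sn -mulnA mulnn leq_mul2r; apply/orP; right; exact: leq_imset_card.
apply: subset_leq_card; apply/fintype.subsetP => _ /imsetP[z zZ ->].
rewrite !inE !andbT /=; move: zZ; rewrite inE => /and3P[/injectiveP fi /injectiveP gi /forallP ht].
have hP i : ((q0 z i).2 < n (q0 z i).1.1.1 (q0 z i).1.2.1)%N by rewrite ffunE /= -!os_base.
pose q : {ffun 'I_k -> blowup_pt} := [ffun i => exist _ (q0 z i) (hP i) : blowup_pt].
have qE l : val (q l) = (z.1.1 (csort z.1.1 l), z.1.2 (csort z.1.2 (s l)), z.2 l).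
  by rewrite ffunE /= ffunE.
apply/imsetP; exists q; last by apply/ffunP => i; rewrite [RHS]ffunE qE ffunE.
rewrite inE; apply/forallP => i; apply/forallP => j; rewrite !qE /=.
by apply/andP; split; apply/implyP => lt; [exact: (csort_lt fi lt) | exact: (csort_lt gi lt)].
Qed.

Lemma sum_base (G : {ffun 'I_k -> 'I_m} -> nat) :
  (\sum_(f : {ffun 'I_k -> cell}) G (base f) = r ^ k * \sum_(h : {ffun 'I_k -> 'I_m}) G h)%N.
Proof.
rewrite (partition_big base xpredT) //= big_distrr /=; apply: eq_bigr => h _.
rewrite (eq_bigr (fun=> G h)) => [|f /eqP->//]; rewrite sum_nat_const; congr (_ * _)%N.
have -> : #|[pred f | base f == h]| = #|family (fun i => [pred x : cell | x.1 == h i])|.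
  apply: eq_card => f; rewrite !inE; apply/eqP/familyP => [<- i|e]; first by rewrite inE ffunE.
  by apply/ffunP => i; have := e i; rewrite inE ffunE => /eqP.
rewrite card_family foldrE big_image /= (eq_bigr (fun=> r)) => [|i _].
  by rewrite prod_nat_const card_ord.
have inj_h : injective (fun t : 'I_r => (h i, t)) by move=> t t' [].
transitivity #|[set (h i, t) | t : 'I_r]|; last by rewrite card_imset // card_ord.
apply: eq_card => x; rewrite unfold_in /=; apply/eqP/imsetP => [<-|[t _ ->]//].
by exists x.2 => //; rewrite -surjective_pairing.
Qed.

End Blowup.

(** In other words, at most a fraction [k ^ 2 / M] of the maps from [k] to [M] elements fail to be
    injective. *)
Lemma ffact_lower M k : (M ^ k.+1 <= M ^_ k * M + k ^ 2 * M ^ k)%N.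
Proof.
elim: k => [|k IH]; first by rewrite ffactn0 expn1 mul1n leq_addr.
have h : (M ^_ k * M <= M ^_ k.+1 + k * M ^ k)%N.
  rewrite ffactnSr; apply: (@leq_trans (M ^_ k * (M - k + k))).
    by rewrite leq_mul2l; apply/orP; right; lia.
  rewrite mulnDr leq_add2l mulnC leq_mul2l; apply/orP; right.
  elim: k {IH} => [|j IHj]; first by rewrite ffactn0.
  by rewrite ffactnSr expnSr leq_mul // leq_subr.
rewrite expnS; apply: leq_trans (leq_mul (leqnn M) IH) _.
rewrite mulnDr; apply: (@leq_trans (M * (M ^_ k.+1 + k * M ^ k) + M * (k ^ 2 * M ^ k))).
  by rewrite leq_add2r leq_mul2l h orbT.
by rewrite !expnS expn0; nia.
Qed.

Section BlowupDensity.
Variables (m r b : nat) (n : 'I_m -> 'I_m -> nat).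
Hypothesis r_gt0 : (0 < r)%N.
Hypothesis n_le : forall x y, (n x y <= b)%N.

(** Each map into blocks lifts to [r ^ k] maps into thin columns or rows. Discarding the pairs with
    [f] or [g] not injective, each worth at most [b ^ k], costs the last term. *)
Lemma blowup_count k (s : 'S_k) :
  (r ^ k * (r ^ k * \sum_(f : {ffun 'I_k -> 'I_m}) \sum_(g : {ffun 'I_k -> 'I_m})
      \prod_i n (os f i) (os g (s i)))
  <= #|[set q | forms (fun z : blowup_pt r b n => cellkey (val z).1.1)
        (fun z : blowup_pt r b n => cellkey (val z).1.2)
      (p := mkp s) q]| * k`! ^ 2
    + 2 * ((m * r) ^ k - (m * r) ^_ k) * (m * r) ^ k * b ^ k)%N.
Proof.
pose X : finType := {ffun 'I_k -> cell m r}.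
pose W (f g : X) := (\prod_i n (os (base f) i) (os (base g) (s i)))%N.
have -> : (r ^ k * (r ^ k * \sum_(f : {ffun 'I_k -> 'I_m}) \sum_(g : {ffun 'I_k -> 'I_m})
      \prod_i n (os f i) (os g (s i)))
   = \sum_(f : X) \sum_(g : X) W f g)%N.
  rewrite big_distrr /=.
  rewrite -(@sum_base m r k (fun h => r ^ k *
    \sum_(g : {ffun 'I_k -> 'I_m}) \prod_i n (os h i) (os g (s i)))%N).
  apply: eq_bigr => f _.
  by rewrite -(@sum_base m r k (fun h => \prod_i n (os (base f) i) (os h (s i)))%N).
apply: leq_trans (leq_add (forms_ge r_gt0 n_le s) (leqnn _)).
have W_le f g : (W f g <= b ^ k)%N.
  by rewrite -[k in (b ^ k)%N]card_ord -prod_nat_const; apply: leq_prod => i _; apply: n_le.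
set J := ((m * r) ^ k - (m * r) ^_ k)%N.
have cX : #|X| = ((m * r) ^ k)%N by rewrite card_ffun card_prod !card_ord.
have cJ : #|[pred f : X | ~~ injectiveb f]| = J.
  have := cardC [pred f : X | injectiveb f]; rewrite cX -cardsE card_inj_ffuns card_prod !card_ord /J => <-.
  by rewrite addKn.
rewrite (bigID (fun f : X => injectiveb f)) /=.
rewrite -[(2 * J)%N]/(2 * J)%N mul2n -addnn !mulnDl addnA; apply: leq_add.
  have -> : (\sum_(f : X | injectiveb f) \sum_(g : X) W f g =
    \sum_(f : X | injectiveb f) \sum_(g : X | injectiveb g) W f g +
    \sum_(f : X | injectiveb f) \sum_(g : X | ~~ injectiveb g) W f g)%N.
    by rewrite -big_split; apply: eq_bigr => f _; rewrite (bigID (fun f : X => injectiveb f)).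
  rewrite leq_add2l; apply: (@leq_trans (\sum_(f : X) J * b ^ k)%N).
    rewrite big_mkcond; apply: leq_sum => f _; case: ifP => // _.
    by rewrite -cJ -sum_nat_const; apply: leq_sum => g _; apply: W_le.
  by rewrite sum_nat_const cX mulnCA mulnA.
rewrite -cJ -cX -mulnA -sum_nat_const; apply: leq_sum => f _.
by rewrite -sum_nat_const; apply: leq_sum => g _; apply: W_le.
Qed.

Lemma blowup_density (R : realType) q (P : perm_t) k (s : 'S_k) :
  (0 < m)%N -> (0 < q)%N -> (\sum_x \sum_y n x y = q * m ^ 2)%N -> tag P = #|{: blowup_pt r b n}| ->
  (k <= r)%N ->
  (#|[set t | forms (fun z : blowup_pt r b n => cellkey (val z).1.1)
        (fun z : blowup_pt r b n => cellkey (val z).1.2)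
      (p := mkp s) t]| <= #|occ (mkp s) P|)%N ->
  (\sum_(f : {ffun 'I_k -> 'I_m}) \sum_(g : {ffun 'I_k -> 'I_m}) \prod_i n (os f i) (os g (s i)))%:R
      / (q ^ k * (m ^ k) ^ 2 * k`!)%:R - (2 * k ^ 2 * b ^ k)%:R / r%:R
    <= density R (mkp s) P.
Proof.
move=> m0 q0 nq tP kr hocc.
have := blowup_count s; move/leq_trans/(_ (leq_add (leq_mul hocc (leqnn _)) (leqnn _))).
set pn := (\sum_f _)%N; set O := #|occ _ _|; set J := (_ - _)%N => h.
have M0 : (0 < m * r)%N by rewrite muln_gt0 m0.
have tPE : tag P = (q * (m * r) ^ 2)%N by rewrite tP card_blowup_pt // nq; nia.
have kP : (k <= tag P)%N by rewrite tPE; nia.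
have -> : density R (mkp s) P = O%:R / 'C(tag P, k)%:R by apply: (@densityE R (mkp s) P kP).
have hJ : (J * r <= k ^ 2 * (m * r) ^ k)%N.
  have := ffact_lower (m * r) k; rewrite /J expnSr => hf.
  apply: (@leq_trans (((m * r) ^ k - (m * r) ^_ k) * (m * r))); first by rewrite leq_mul2l; nia.
  by rewrite mulnBl leq_subLR.
have hC : ('C(tag P, k) * k`! <= (q * (m * r) ^ 2) ^ k)%N.
  rewrite bin_ffact -tPE; elim: (k) => [|j IHj]; first by rewrite ffactn0.
  by rewrite ffactnSr expnSr leq_mul // leq_subr.
have C0 : (0 < 'C(tag P, k))%N by rewrite bin_gt0.
set N := ((q * (m * r) ^ 2) ^ k)%N in hC.
have NE : N = (q ^ k * (m ^ k) ^ 2 * (r ^ k) ^ 2)%N 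
  by rewrite /N expnMn -(expnM (m * r)%N) [(2 * k)%N]mulnC expnM [((m * r) ^ k)%N]expnMn expnMn mulnA.
have N0 : (0 < N)%N by rewrite expn_gt0 muln_gt0 q0 expn_gt0 M0.
set Y := (2 * J * (m * r) ^ k * b ^ k)%N in h.
have hY : (Y * r <= 2 * k ^ 2 * b ^ k * (N * k`!))%N.
  have hN : ((m * r) ^ k * (m * r) ^ k <= N * k`!)%N.
    rewrite -[leqLHS]muln1; apply: leq_mul (fact_gt0 k).
    by rewrite NE expnMn; have : (0 < q ^ k)%N by [rewrite expn_gt0 q0]; nia.
  rewrite /Y; apply: (@leq_trans (2 * b ^ k * ((m * r) ^ k * (J * r)))); first by nia.
  apply: (@leq_trans (2 * b ^ k * ((m * r) ^ k * (k ^ 2 * (m * r) ^ k)))).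
    by rewrite !leq_mul2l hJ !orbT.
  apply: (@leq_trans (2 * k ^ 2 * b ^ k * ((m * r) ^ k * (m * r) ^ k))); first by nia.
  by rewrite leq_mul2l hN orbT.
have r0' : r%:R != 0 :> R by rewrite pnatr_eq0 -lt0n.
have q0' : q%:R != 0 :> R by rewrite pnatr_eq0 -lt0n.
have m0' : m%:R != 0 :> R by rewrite pnatr_eq0 -lt0n.
have f0' : k`!%:R != 0 :> R by rewrite pnatr_eq0 -lt0n fact_gt0.
have C0' : 0 < 'C(tag P, k)%:R :> R by rewrite ltr0n.
have Nf0 : 0 < (N * k`!)%:R :> R by rewrite ltr0n muln_gt0 N0 fact_gt0.
have -> : pn%:R / (q ^ k * (m ^ k) ^ 2 * k`!)%:R = (r ^ k * (r ^ k * pn))%:R / (N * k`!)%:R :> R.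
  by rewrite NE !natrM !natrX; field; rewrite f0' !expf_neq0.
rewrite lerBlDr; apply: (@le_trans _ _ ((O * k`! ^ 2 + Y)%:R / (N * k`!)%:R)).
  by rewrite ler_pM2r ?invr_gt0 // ler_nat.
rewrite natrD mulrDl; apply: lerD.
  rewrite ler_pdivrMr // mulrAC ler_pdivlMr // -!natrM ler_nat.
  apply: (@leq_trans (O * ('C(tag P, k) * k`! * k`!))); first by nia.
  by rewrite leq_mul2l leq_mul2r hC !orbT.
by rewrite ler_pdivrMr // mulrAC ler_pdivlMr ?ltr0n // -!natrM ler_nat.
Qed.

End BlowupDensity.

(** The numerators become the numbers of points per thin square, which is why the perturbation is
    carried out over [rat]. *)
Lemma common_denominator (T : finType) (A : T -> rat) : (forall z, 0 <= A z) ->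
  exists2 q : nat, (0 < q)%N & exists n : T -> nat, forall z, A z = (n z)%:R / q%:R.
Proof.
move=> A0; pose den z := `|denq (A z)|%N.
have den0 z : (0 < den z)%N by rewrite absz_gt0 denq_neq0.
exists (\prod_z den z)%N; first by apply: prodn_gt0.
exists (fun z => `|numq (A z)| * \prod_(y | y != z) den y)%N => z.
have p0 : (0 < \prod_(y | y != z) den y)%N by apply: prodn_gt0.
have -> : (\prod_y den y = den z * \prod_(y | y != z) den y)%N by rewrite (bigD1 z).
rewrite !natrM -mulf_div divff ?mulr1 ?pnatr_eq0 -?lt0n //.
by rewrite !natr_absz (gtr0_norm (denq_gt0 _)) ger0_norm ?numq_ge0 // divq_num_den.
Qed.

Lemma sum_pden (F : numFieldType) m (A : 'I_m -> 'I_m -> F) k : (0 < m)%N ->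
  \sum_x \sum_y A x y = m%:R ^+ 2 -> \sum_(s : 'S_k) pden A (mkp s) = k`!%:R.
Proof.
move=> m0 hA; rewrite (eq_bigr (fun s => pnum A s / (m%:R ^+ k) ^+ 2)) // -mulr_suml.
rewrite sum_pnum hA -mulr_natl -!exprM [(2 * k)%N]mulnC mulfK //.
by rewrite expf_neq0 // pnatr_eq0 -lt0n.
Qed.

Lemma step_approx (R : realType) m (A : 'I_m -> 'I_m -> rat) K (e : R) :
  (0 < m)%N -> (forall x y, 0 <= A x y) -> \sum_x \sum_y A x y = m%:R ^+ 2 -> 0 < e ->
  exists P : perm_t, forall p, (tag p <= K)%N ->
    `|density R p P - ratr (pden A p) / (tag p)`!%:R| <= e.
Proof.
move=> m0 A0 hA e0.
have [|q q0 [n' hn]] := @common_denominator ('I_m * 'I_m)%type (fun z => A z.1 z.2).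
  by move=> z; apply: A0.
pose n x y := n' (x, y); have {}hn x y : A x y = (n x y)%:R / q%:R := hn (x, y).
have q0' : q%:R != 0 :> rat by rewrite pnatr_eq0 -lt0n.
pose b := (\sum_x \sum_y n x y)%N.
have n_le x y : (n x y <= b)%N.
  by rewrite /b (bigD1 x) //= (bigD1 y) //= -addnA leq_addr.
have nq : b = (q * m ^ 2)%N.
  apply/eqP; rewrite -(eqr_nat rat) natrM natrX -hA mulr_sumr /b natr_sum; apply/eqP.
  apply: eq_bigr => x _; rewrite natr_sum mulr_sumr; apply: eq_bigr => y _.
  by rewrite hn mulrC divfK.
(* [c / r] dominates [k!] times the sampling error for all orders up to [K] at once, as powers of
   [b.+1] do not decrease with the exponent. The summand [K.+1] of [r] ensures [k <= r]. *)
pose c := (2 * K ^ 2 * b.+1 ^ K * K`!)%N.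
pose r := (K.+1 + Num.bound (c%:R / e))%N.
have r0 : (0 < r)%N by [].
have [P [tP hP]] := realize (fun z : blowup_pt r b n => cellkey (val z).1.1)
  (fun z : blowup_pt r b n => cellkey (val z).1.2).
exists P => -[k s] /= kK.
have kr : (k <= r)%N by rewrite /r; lia.
have kP : (k <= tag P)%N.
  rewrite tP card_blowup_pt // -/b nq; apply: leq_trans kr _; nia.
pose D (s : 'S_k) : R := ratr (pden A (mkp s)) / k`!%:R.
have fk0 : k`!%:R != 0 :> R by rewrite pnatr_eq0 -lt0n fact_gt0.
have D1 : \sum_s D s = 1.
  by rewrite -mulr_suml -rmorph_sum /= sum_pden //= rmorph_nat divff.
have low (t : 'S_k) : D t - (2 * k ^ 2 * b ^ k)%:R / r%:R <= density R (mkp t) P.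
  apply: le_trans (blowup_density r0 n_le R m0 q0 nq tP kr (hP (mkp t))).
  rewrite lerD2r /D le_eqVlt; apply/orP; left; apply/eqP.
  have -> : pden A (mkp t) = (\sum_(f : {ffun 'I_k -> 'I_m}) \sum_(g : {ffun 'I_k -> 'I_m})
      \prod_i n (os f i) (os g (t i)))%:R / (q ^ k * (m ^ k) ^ 2)%:R.
    rewrite /pden /pnum /= natrM !natrX invfM mulrA; congr (_ / _).
    rewrite natr_sum mulr_suml; apply: eq_bigr => f _; rewrite natr_sum mulr_suml; apply: eq_bigr => g _.
    rewrite natr_prod -[k in q%:R ^+ k]card_ord -prodr_const -prodf_div; apply: eq_bigr => i _.
    exact: hn.
  by rewrite rmorphM /= fmorphV /= !ratr_nat [in RHS]natrM invfM mulrA.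
apply: le_trans (density_two_sided kP D1 low s) _.
rewrite -mulrnAl -mulrnA ler_pdivrMr ?ltr0n //.
have h : 0 <= c%:R / e by rewrite divr_ge0 // ltW.
have := archi_boundP h; rewrite ltr_pdivrMr // => hc.
apply: (@le_trans _ _ c%:R).
  rewrite ler_nat /c; apply: leq_mul; last exact: leq_fact.
  apply: leq_mul; first by rewrite leq_mul2l /= leq_sqr.
  apply: (@leq_trans (b.+1 ^ k)); last by rewrite leq_pexp2l.
  by case: (k) => // j; rewrite leq_exp2r.
apply: le_trans (ltW hc) _; rewrite mulrC ler_pM2l // ler_nat /r; lia.
Qed.

Import numFieldNormedType.Exports.

(** * At most three patterns are not forcing *)

Section ThreeSymmetric.

(* In this permutation every pattern of order at most 3 has exactly its quasirandom density. *)
Definition sym9 : seq nat := [:: 3; 4; 9; 8; 5; 2; 1; 6; 7]%N.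

(** A version of [forms] on lists, which lets the copies in [sym9] be enumerated by computation. *)
Definition good9 (pl l : seq nat) : bool := all (fun i => all (fun j =>
  ((i < j) ==> (nth 0 l i < nth 0 l j))%N
    && ((nth 0 pl i < nth 0 pl j) ==> (nth 0 sym9 (nth 0 l i) < nth 0 sym9 (nth 0 l j)))%N)
  (iota 0 (size pl))) (iota 0 (size pl)).

Definition occ9 (pl : seq nat) : seq (seq nat) :=
  [seq l <- iter (size pl) (fun L => [seq x :: l | x <- iota 0 9, l <- L]) [:: [::]] | good9 pl l].

Lemma occ9_count : all (fun k => all (fun pl => [&& uniq (occ9 pl),
    all (fun l => (size l == k) && all (fun x => x < 9)%N l) (occ9 pl) & ('C(9, k) <= k`! * size (occ9 pl))%N])
  (permutations (iota 0 k))) [:: 0; 1; 2; 3]%N.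
Proof. by vm_compute. Qed.

Lemma forms9 k (s : 'S_k) : (k <= 3)%N ->
  ('C(9, k) <= k`! * #|[set q : {ffun 'I_k -> 'I_9} |
    forms val (fun i : 'I_9 => nth 0%N sym9 i) (p := mkp s) q]|)%N.
Proof.
move=> k3; pose pl := [seq val (s i) | i <- enum 'I_k].
have szp : size pl = k by rewrite size_map size_enum_ord.
have kin : k \in [:: 0; 1; 2; 3]%N by case: (k) k3 => [|[|[|[|]]]].
have plin : pl \in permutations (iota 0 k).
  rewrite mem_permutations; apply: uniq_perm; rewrite ?iota_uniq //.
    rewrite map_inj_uniq ?enum_uniq // => i j /val_inj/perm_inj //.
  move=> x; rewrite mem_iota add0n; apply/mapP/idP => [[i _ ->]|xk]; first exact: ltn_ord.
  by exists (s^-1%g (Ordinal xk)); rewrite ?mem_enum // permKV.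
have /allP/(_ _ kin)/allP/(_ _ plin)/and3P[ul /allP hl hc] := occ9_count.
apply: leq_trans hc _; rewrite leq_mul2l; apply/orP; right.
pose q l : {ffun 'I_k -> 'I_9} := [ffun i : 'I_k => inord (nth 0%N l i)].
have qE l i : l \in occ9 pl -> val (q l i) = nth 0%N l i.
  move=> /hl/andP[/eqP sl /allP h9]; rewrite ffunE /= inordK //.
  by apply: h9; rewrite mem_nth // sl.
rewrite -(size_map q) cardE; apply: uniq_leq_size.
  rewrite map_inj_in_uniq // => l l' ll ll' e.
  have /andP[/eqP sl _] := hl _ ll; have /andP[/eqP sl' _] := hl _ ll'.
  apply: (@eq_from_nth _ 0%N); rewrite sl ?sl' // => i ik.
  by rewrite -(qE l (Ordinal ik) ll) -(qE l' (Ordinal ik) ll') e.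
move=> _ /mapP[l ll ->]; rewrite mem_enum inE; apply/forallP => i; apply/forallP => j.
rewrite !(qE l) //; move: ll; rewrite mem_filter => /andP[/allP g _].
have inI (x : 'I_k) : val x \in iota 0 (size pl) by rewrite mem_iota szp add0n ltn_ord.
have /allP/(_ _ (inI j)) := g _ (inI i).
have plE (x : 'I_k) : nth 0%N pl x = val (s x).
  by rewrite (nth_map x) -?enumT ?size_enum_ord // nth_ord_enum.
by rewrite !plE.
Qed.

(** The enumeration gives each pattern at least its share of the subsets; [density_two_sided] with
    error 0 turns this into equality. *)
Lemma ex_three_symmetric (R : realType) : exists P : perm_t, tag P = 9%N /\
  forall p, (tag p <= 3)%N -> density R p P = (tag p)`!%:R^-1.
Proof.
have [P [tP hP]] := realize val (fun i : 'I_9 => nth 0%N sym9 i).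
rewrite card_ord in tP; exists P; split=> // -[k s] /= k3.
have kP : (k <= tag P)%N by rewrite tP; apply: leq_trans k3 _.
have f0 : k`!%:R != 0 :> R by rewrite pnatr_eq0 -lt0n fact_gt0.
have sum1 : \sum_(t : 'S_k) k`!%:R^-1 = 1 :> R.
  have cS : #|{: 'S_k}| = k`! by rewrite -card_Sn; apply: eq_card.
  by rewrite sumr_const cS -[LHS]mulr_natr mulVf.
have low (t : 'S_k) : k`!%:R^-1 - 0 <= density R (mkp t) P.
  have -> : density R (mkp t) P = #|occ (mkp t) P|%:R / 'C(9, k)%:R.
    by rewrite (@densityE R (mkp t) P kP) [in 'C(tag P, _)]tP.
  have C0 : (0 < 'C(9, k))%N by rewrite bin_gt0 -tP.
  rewrite subr0 ler_pdivlMr ?ltr0n // mulrC ler_pdivrMr ?ltr0n ?fact_gt0 // -natrM ler_nat mulnC.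
  by apply: leq_trans (forms9 t k3) _; rewrite leq_mul2l; apply/orP; right; apply: (hP (mkp t)).
have := density_two_sided kP sum1 low s.
by rewrite mul0rn normr_le0 subr_eq0 => /eqP.
Qed.

End ThreeSymmetric.

Lemma cvg_harmonic_le (R : realType) (u : nat -> R) (l C : R) :
  (forall i, `|u i - l| <= C / i.+1%:R) -> (u @ \oo --> l)%classic.
Proof.
move=> h; apply/cvgrPdist_le => e e0.
have C0 : 0 <= C by have := le_trans (normr_ge0 _) (h 0%N); rewrite divr1.
have Ce : 0 <= C / e by rewrite divr_ge0 // ltW.
exists (Num.bound (C / e)) => // i /= Ni; rewrite distrC; apply: le_trans (h i) _.
rewrite ler_pdivrMr ?ltr0n // mulrC -ler_pdivrMr //.
by apply: le_trans (ltW (archi_boundP Ce)) _; rewrite ler_nat ltnW // ltnS.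
Qed.

(* [a i p] is (porder p)! times the density of p in the i-th step measure, which P i samples. *)
Lemma perturbed_sequence (R : realType) (rho : perm_t) (l : seq perm_t) K :
  uniq (rho :: l) -> indep rat (rho :: l) -> (forall p, p \in rho :: l -> 0 < porder p <= K)%N ->
  exists (P : nat -> perm_t) (a : nat -> perm_t -> R) (t : R), 0 < t /\
    [/\ forall i p, (porder p <= K)%N -> `|density R p (P i) - a i p / (porder p)`!%:R| <= i.+1%:R^-1,
      forall i, {in l, forall p, `|a i p - 1| <= i.+1%:R^-1},
      forall i, `|a i rho - (1 + t)| <= i.+1%:R^-1 &
      forall i k, \sum_(s : 'S_k) a i (mkp s) = k`!%:R].
Proof.
move=> ul il hl; pose p := tnth (in_tuple (rho :: l)).
have K0 : (0 < K)%N by have /andP[r0 rK] := hl rho (mem_head _ _); apply: leq_trans r0 rK.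
have p_inj : injective p by apply/tuple_uniqP.
have p_indep : indep rat [seq p i | i <- enum 'I_(size (rho :: l))] by rewrite map_tnth_enum.
have p_order i : (0 < tag (p i) <= K)%N by apply: hl; apply: mem_tnth.
have [t t0 ht] := perturb K0 p_inj p_indep p_order ord0.
have /choice[A hA] : forall i : nat, exists A : 'I_K -> 'I_K -> rat,
    [/\ forall x y, 0 <= A x y, \sum_x \sum_y A x y = K%:R ^+ 2 &
    forall j, `|pden A (p j) - 1 - t *+ (j == ord0)| <= i.+1%:R^-1].
  by move=> i; apply: ht; rewrite invr_gt0 ltr0n.
have /choice[P hP] : forall i : nat, exists P : perm_t, forall p, (tag p <= K)%N ->
    `|density R p P - ratr (pden (A i) p) / (tag p)`!%:R| <= i.+1%:R^-1.
  by move=> i; have [A0 A1 _] := hA i; apply: step_approx => //; rewrite invr_gt0 ltr0n.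
have ratr_le (x : rat) i : `|x| <= i.+1%:R^-1 -> `|ratr x : R| <= i.+1%:R^-1.
  by move=> h; rewrite -(ratr_nat R i.+1) -fmorphV -ratr_norm ler_rat.
exists P, (fun i q => ratr (pden (A i) q)), (ratr t); split; first by rewrite ltr0q.
split=> // [i q ql|i|i k].
- have [_ _ h] := hA i.
  have qi : (index q l < size l)%N by rewrite index_mem.
  have := h (lift ord0 (Ordinal qi : 'I_(size l))).
  rewrite (_ : p _ = q) ?subr0 => [/ratr_le|].
    by rewrite rmorphB rmorph1.
  by rewrite /p (tnth_nth rho) /= nth_index.
- have [_ _ /(_ ord0)] := hA i; rewrite eqxx mulr1n => /ratr_le.
  by rewrite !rmorphB rmorph1 -addrA -opprD (_ : p ord0 = rho) // /p (tnth_nth rho).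
- have [_ A1 _] := hA i.
  by rewrite -rmorph_sum /= sum_pden // ratr_nat.
Qed.

(* [determines l x]: if the patterns in [l] have their quasirandom density, then so does [x],
   because the densities of all patterns of order k add up to 1. *)
Definition determines (l : seq perm_t) (x : perm_t) := forall G : perm_t -> Prop,
  (forall p, p \in l -> G p) -> (forall p, (porder p <= 1)%N -> G p) ->
  (forall s t : 'S_2, G (mkp s) -> G (mkp t)) -> G x.

Lemma determines_mem l x : x \in l -> determines l x.
Proof. by move=> xl G h _ _; apply: h. Qed.

Lemma determines_small l x : (porder x <= 1)%N -> determines l x.
Proof. by move=> x1 G _ h _; apply: h. Qed.

(** * Independent lists for at most three patterns *)

Definition base_of (l : seq perm_t) (c : perm_t) :=
  [/\ uniq l, indep rat l, forall p, p \in l -> (0 < porder p <= porder c)%N & determines l c].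

Lemma base1 c : (4 <= porder c)%N -> base_of [:: c] c.
Proof.
move=> c4; split=> //.
- by apply: indep_cons => //; lia.
- by move=> p; rewrite inE => /eqP->; lia.
- by apply: determines_mem; rewrite inE.
Qed.

Lemma base2 b c : (4 <= porder c)%N -> (porder b <= porder c)%N ->
  exists l, base_of l c /\ determines l b.
Proof.
move=> c4 bc; have [b1|b2] := leqP (porder b) 1.
  by exists [:: c]; split; [apply: base1 | apply: determines_small].
have [e|neq] := eqVneq b c.
  by exists [:: c]; rewrite e; split; [apply: base1 | apply: determines_mem; rewrite inE].
exists [:: c; b]; split; last by apply: determines_mem; rewrite !inE eqxx orbT.
split; first by rewrite /= inE eq_sym neq.
- move: bc; rewrite leq_eqVlt => /predU1P[|bc]; last first.
    apply: indep_cons => [||]; first lia.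
      by move=> q; rewrite inE => /eqP->; lia.
    by apply: indep_cons => //; lia.
  move: b c c4 b2 neq => [kb sb] [kc sc] /= c4 b2 neq e; subst kc.
  case: kb sb sc neq c4 b2 => [|d] sb sc neq c4 b2; first by [].
  by apply: indep_same2; [lia | apply: contra_neq neq => ->].
- by move=> p; rewrite !inE => /orP[]/eqP->; lia.
- by apply: determines_mem; rewrite inE eqxx.
Qed.

(** Repetitions and orders at most 1 are discarded. A pattern of strictly largest order is split off
    by [indep_cons]; two of largest order above a smaller one are handled by [indep_mixed], three of
    equal order by [indep_same3]. *)
Lemma base3 a b c : (4 <= porder c)%N -> (porder a <= porder b)%N -> (porder b <= porder c)%N ->
  exists l, [/\ base_of l c, determines l a & determines l b].
Proof.
move=> c4 ab bc.
have [a1|a2] := leqP (porder a) 1.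
  have [l [bl dl]] := base2 c4 bc; exists l; split=> //; exact: determines_small.
have [eab|nab] := eqVneq a b.
  by have [l [bl dl]] := base2 c4 bc; exists l; rewrite eab.
have [ebc|nbc] := eqVneq b c.
  have [l [bl dl]] := base2 c4 (leq_trans ab bc); exists l; split=> //.
  by rewrite ebc; case: bl.
have [eac|nac] := eqVneq a c.
  have [l [bl dl]] := base2 c4 bc; exists l; split=> //.
  by rewrite eac; case: bl.
have ulcab : uniq [:: c; a; b] by rewrite /= !inE negb_or ![c == _]eq_sym nac nbc nab.
have fin l : perm_eq l [:: c; a; b] -> indep rat l ->
    exists l, [/\ base_of l c, determines l a & determines l b].
  move=> pl il; have m x : (x \in l) = (x \in [:: c; a; b]) := perm_mem pl x.
  exists l; split; last 2 first.
  - by apply: determines_mem; rewrite m !inE eqxx !orbT.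
  - by apply: determines_mem; rewrite m !inE eqxx !orbT.
  split=> //; first by rewrite (perm_uniq pl).
  - by move=> p; rewrite m !inE => /or3P[]/eqP->; lia.
  - by apply: determines_mem; rewrite m !inE eqxx.
have [bc'|cb] := ltnP (porder b) (porder c).
  have [ab'|ba] := ltnP (porder a) (porder b).
    apply: (fin [:: c; b; a]).
      by apply/seq.permP => f /=; lia.
    apply: indep_cons; first lia.
      by move=> q; rewrite !inE => /orP[]/eqP->; lia.
    apply: indep_cons; first lia.
      by move=> q; rewrite !inE => /eqP->; lia.
    by apply: indep_cons => //; lia.
  have [a3|a2'] := leqP 3 (porder a).
    apply: (fin [:: c; a; b]) => //; apply: indep_cons; first lia.
      by move=> q; rewrite !inE => /orP[]/eqP->; lia.
    have e : porder a = porder b by lia.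
    move: a b {ab bc nbc nac ulcab fin bc' ba a2} nab a3 e => [ka sa] [kb sb] /= nab a3 e; subst kb.
    case: ka sa sb nab a3 => [|d] sa sb nab a3; first by [].
    by apply: indep_same2; [lia | apply: contra_neq nab => ->].
  (* Here [a] and [b] are the two patterns of order 2, whose gradients add up to a constant: only
     [b] is kept, and it determines [a]. *)
  have [l [bl dl]] := base2 c4 bc; exists l; split=> // G h1 h2 h3.
  have := dl G h1 h2 h3.
  have ea : porder a = 2%N by lia.
  have eb : porder b = 2%N by lia.
  move: a b ea eb {ab bc nbc nac nab ulcab fin bc' ba a2 a2' dl} => [ka sa] [kb sb] /= ea eb.
  subst ka kb; exact: h3.
have e : porder b = porder c by lia.
have [ac|ca] := ltnP (porder a) (porder c).
  apply: (fin [:: a; b; c]); first by apply/seq.permP => f /=; lia.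
  move: a b c e a2 ac c4 {ab bc nac nab ulcab fin cb} nbc => [ka sa] [kb sb] [kc sc] /= e a2 ac c4 nbc.
  subst kb; case: ka sa a2 ac => [|d] sa a2 ac; first by [].
  case: kc sb sc c4 ac nbc => [|D] sb sc c4 ac nbc; first by [].
  by apply: indep_mixed; [lia | lia | apply: contra_neq nbc => ->].
have e' : porder a = porder c by lia.
apply: (fin [:: a; b; c]); first by apply/seq.permP => f /=; lia.
move: a b c e e' c4 {ab bc ulcab fin cb a2 ca} nab nac nbc => [ka sa] [kb sb] [kc sc] /= e e' c4 nab nac nbc.
subst ka kb; case: kc sa sb sc c4 nab nac nbc => [|d] sa sb sc c4 nab nac nbc; first by [].
by apply: indep_same3; [lia | apply: contra_neq nab => -> | apply: contra_neq nac => ->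
  | apply: contra_neq nbc => ->].
Qed.

(** * Refuting forcing sets with at most three elements *)

Local Open Scope classical_set_scope.

Lemma density_large (R : realType) (p P : perm_t) : (porder P < porder p)%N -> density R p P = 0.
Proof. by rewrite ltnNge /density => /negPf->. Qed.

Lemma forcing_order (R : realType) (S : set perm_t) : forcing R S -> ~ (forall p, S p -> (porder p <= 3)%N).
Proof.
move=> fS hS; have [P [tP hP]] := ex_three_symmetric R.
(* Order 10 exceeds the order 9 of [P], so this pattern has density 0 all along the constant
   sequence. *)
pose p : perm_t := mkp (1%g : 'S_10).
have h := fS (fun=> P) _ p.
have {}h : (density R p P @[i --> \oo] --> ((porder p)`!%:R^-1 : R)).
  by apply: h => q /hS q3; rewrite hP //; apply: cvg_cst.
have h0 : (density R p P @[i --> \oo] --> (0 : R)).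
  have -> : density R p P = 0 by apply: density_large; rewrite /porder tP.
  exact: cvg_cst.
have /eqP : (porder p)`!%:R^-1 = 0 :> R by apply: cvg_unique h h0; apply: norm_hausdorff.
by rewrite invr_eq0 pnatr_eq0 -leqn0 leqNgt fact_gt0.
Qed.

Lemma forcing_three (R : realType) (S : set perm_t) a b c : forcing R S ->
  (forall x, S x -> [\/ x = a, x = b | x = c]) ->
  (4 <= porder c)%N -> (porder a <= porder b)%N -> (porder b <= porder c)%N -> False.
Proof.
move=> fS hS c4 ab bc; have [l [[ul il hl dc] da db]] := base3 c4 ab bc.
(* Being one order above [c] keeps [rho] out of [l] and lets [indep_cons] apply. *)
pose rho : perm_t := mkp (1%g : 'S_(porder c).+1).
have rhoE : porder rho = (porder c).+1 by [].
have rl : rho \notin l by apply/negP => /hl/andP[_]; rewrite rhoE ltnn.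
have irho : indep rat (rho :: l).
  apply: indep_cons => [|q /hl|]; rewrite ?rhoE ?ltnS //.
  by apply: leq_trans c4.
have url : uniq (rho :: l) by rewrite /= rl.
have orl p : p \in rho :: l -> (0 < porder p <= (porder c).+1)%N.
  rewrite inE => /predU1P[->|/hl/andP[p0 pc]]; first by rewrite rhoE leqnn.
  by rewrite p0 leqW.
have [P [a' [t [t0 [hP hl' hrho hsum]]]]] := perturbed_sequence R url irho orl.
have lim p L : (porder p <= (porder c).+1)%N -> (forall i, `|a' i p - L| <= i.+1%:R^-1) ->
    density R p (P i) @[i --> \oo] --> (L / (porder p)`!%:R : R).
  move=> pc hL; apply: (@cvg_harmonic_le R (fun i => density R p (P i)) (L / (porder p)`!%:R) 2) => i.
  have -> : density R p (P i) - L / (porder p)`!%:R =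
    (density R p (P i) - a' i p / (porder p)`!%:R) + (a' i p - L) / (porder p)`!%:R by ring.
  apply: le_trans (ler_normD _ _) _; have := hP i p pc.
  have : `|(a' i p - L) / (porder p)`!%:R| <= i.+1%:R^-1.
    rewrite normrM normfV normr_nat ler_pdivrMr ?ltr0n ?fact_gt0 //.
    by apply: le_trans (hL i) _; rewrite ler_peMr ?invr_ge0 // ler1n fact_gt0.
  by rewrite [2 / _]mulrDl div1r => hB hA; apply: lerD.
have G x : determines l x -> forall i, `|a' i x - 1| <= i.+1%:R^-1.
  move=> dx i; apply: (dx (fun x => `|a' i x - 1| <= i.+1%:R^-1)).
  - by move=> p pl; apply: hl'.
  (* For order at most 1 there is a single permutation, so the sum rule fixes its weight at 1. *)
  - move=> [k s] /= k1.
    have := hsum i k; rewrite (bigD1 s) //= big1 ?addr0 => [->|u us].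
      by case: k {s} k1 => [|[|]] // _; rewrite ?fact0 ?(factS 0) subrr normr0 invr_ge0.
    case/eqP: us; apply/permP => x0.
    by case: k s u k1 x0 => [|[|]] // s u _ x0; [case: x0 | rewrite !ord1].
  (* The two weights of order 2 add up to 2, so their deviations from 1 are opposite. *)
  - move=> s u hs; have [<-//|su] := eqVneq s u.
    have := hsum i 2; rewrite (bigD1 s) //= (bigD1 u) 1?eq_sym //= big1 ?addr0.
      move=> e; have -> : a' i (mkp u) - 1 = - (a' i (mkp s) - 1).
        by have : (2`!%:R = 2 :> R) by []; lra.
      by rewrite normrN.
    move=> v /andP[vs vu]; exfalso.
    have u3 : uniq [:: s; u; v] by rewrite /= !inE negb_or su ![_ == v]eq_sym vs vu.
    have := uniq_leq_size u3 (fun w _ => mem_enum 'S_2 w); rewrite -cardE.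
    by rewrite (_ : #|_| = 2`!) // -card_Sn; apply: eq_card.
have cv x : S x -> density R x (P i) @[i --> \oo] --> ((porder x)`!%:R^-1 : R).
  move=> Sx; have [xc dx] : (porder x <= porder c)%N /\ determines l x.
    by case: (hS x Sx) => ->; split=> //; apply: leq_trans bc.
  rewrite -div1r; apply: lim; first exact: leqW.
  exact: G.
have h1 := fS P cv rho; have h2 := lim rho (1 + t) (leqnn _) hrho.
have f0 : (porder rho)`!%:R != 0 :> R by rewrite pnatr_eq0 -lt0n fact_gt0.
have : (porder rho)`!%:R^-1 = (1 + t) / (porder rho)`!%:R.
  by apply: cvg_unique h1 h2; apply: norm_hausdorff.
move/(congr1 (fun x => x * (porder rho)`!%:R)); rewrite mulVf // mulfVK // => e.
by move: t0; rewrite -(ltrD2l 1) addr0 -e ltxx.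
Qed.

Theorem theorem1 (R : realType) (S : set perm_t) :
  forcing R S ->
  exists a b c d : perm_t,
    (S a /\ S b /\ S c /\ S d) /\
    (a <> b /\ a <> c /\ a <> d /\ b <> c /\ b <> d /\ c <> d).
Proof.
move=> fS; apply: contrapT => no4.
have [a [b [c hS]]] : exists a b c, forall x, S x -> [\/ x = a, x = b | x = c].
  (* Any pattern serves as a name when [S] is empty; for one or two elements, names are repeated. *)
  pose e : perm_t := mkp (1%g : 'S_0).
  have [[a Sa]|nS] := pselect (exists a, S a); last first.
    by exists e, e, e => x Sx; case: nS; exists x.
  have [[b [Sb ab]]|nb] := pselect (exists b, S b /\ a <> b); last first.
    exists a, a, a => x Sx; constructor 1; apply: contrapT => xa; apply: nb.
    by exists x; split=> // ax; apply: xa.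
  have [[c [Sc [ac bc]]]|nc] := pselect (exists c, S c /\ a <> c /\ b <> c); last first.
    exists a, b, b => x Sx; have [->|xa] := pselect (x = a); first by constructor 1.
    constructor 2; apply: contrapT => xb; apply: nc.
    by exists x; split=> //; split=> e'; [apply: xa | apply: xb].
  exists a, b, c => x Sx; have [->|xa] := pselect (x = a); first by constructor 1.
  have [->|xb] := pselect (x = b); first by constructor 2.
  constructor 3; apply: contrapT => xc; apply: no4; exists a, b, c, x; split=> //.
  by do !split=> //; move=> e'; [apply: xa | apply: xb | apply: xc].
have sorted_case x y z : (forall w, S w -> [\/ w = x, w = y | w = z]) ->
    (porder x <= porder y)%N -> (porder y <= porder z)%N -> False.
  move=> h xy yz; have [z4|z3] := leqP 4 (porder z).
    exact: (forcing_three fS h z4 xy yz).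
  by apply: (forcing_order fS) => w /h[]->; lia.
have [ab|/ltnW ba] := leqP (porder a) (porder b); have [bc|/ltnW cb] := leqP (porder b) (porder c).
- exact: (sorted_case a b c).
- have [ac|/ltnW ca] := leqP (porder a) (porder c).
    by apply: (sorted_case a c b) => // w /hS[] ->; [constructor 1 | constructor 3 | constructor 2].
  by apply: (sorted_case c a b) => // w /hS[] ->; [constructor 2 | constructor 3 | constructor 1].
- have [ac|/ltnW ca] := leqP (porder a) (porder c).
    by apply: (sorted_case b a c) => // w /hS[] ->; [constructor 2 | constructor 1 | constructor 3].
  by apply: (sorted_case b c a) => // w /hS[] ->; [constructor 3 | constructor 1 | constructor 2].
- by apply: (sorted_case c b a) => // w /hS[] ->; [constructor 3 | constructor 2 | constructor 1].
Qed.
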